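(* Let $\mathbb{F}$ be a field with $\operatorname{char}\mathbb{F}\neq 2,3$, and let $s_1,s_2$ be Steinitz numbers. The groups $SL_{s_1}^p(\mathbb{F})$ and $SL_{s_2}^p(\mathbb{F})$ are isomorphic if and only if $s_1=s_2$.
   Context: A Steinitz number is a formal product $\prod_{p}p^{r_p}$ over all primes $p$ with $r_p\in\mathbb{N}\cup\{0,\infty\}$; Steinitz numbers are multiplied by adding exponents (with $\infty$ absorbing), and $s_2\mid s_1$ if $s_1=s_2s_3$ for some Steinitz number $s_3$. An $(\mathbb{N}\times\mathbb{N})$-matrix over $\mathbb{F}$ is $n$-periodic if it is block-diagonal of the form $\operatorname{diag}(a,a,\ldots)$ with $a\in M_n(\mathbb{F})$. $M_n^p(\mathbb{F})\cong M_n(\mathbb{F})$ is the algebra of all $n$-periodic matrices, and $GL_n^p(\mathbb{F})$ is its group of invertible elements. For a Steinitz number $s$, $M_s^p(\mathbb{F})=\bigcup_{n\mid s}M_n^p(\mathbb{F})$ and $GL_s^p(\mathbb{F})=\bigcup_{n\mid s}GL_n^p(\mathbb{F})$ (unions over positive integers $n$ dividing $s$), the latter being the group of all invertible elements of $M_s^p(\mathbb{F})$. $SL_s^p(\mathbb{F})=[GL_s^p(\mathbb{F}),GL_s^p(\mathbb{F})]$ is the commutator subgroup. *)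

(* Defs.v *)
From HB Require Import structures.
From mathcomp Require Import all_boot all_order all_algebra.
From mathcomp Require Import all_classical.
From mathcomp Require Import zify.

Set Implicit Arguments.
Unset Strict Implicit.
Unset Printing Implicit Defensive.

Import GRing.Theory.

Local Open Scope classical_set_scope.
Local Open Scope ring_scope.

(* The exponent [None] stands for infinity. *)
Definition steinitz : Type := {p : nat | prime p} -> option nat.

Definition exponent_add (r1 r2 : option nat) : option nat :=
  if r1 is Some a then if r2 is Some b then Some (a + b)%N else None else None.

Definition steinitz_mul (s1 s2 : steinitz) : steinitz :=
  fun p => exponent_add (s1 p) (s2 p).

Definition steinitz_dvd (s2 s1 : steinitz) : Prop :=
  exists s3 : steinitz, s1 = steinitz_mul s2 s3.

(* Meaningful for [0 < n] only. *)
Definition steinitz_of_nat (n : nat) : steinitz :=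
  fun p => Some (logn (val p) n).

Definition nxn_matrix (F : Type) : Type := nat -> nat -> F.

Section PeriodicMatrices.
Variable F : fieldType.
Implicit Types (A B : nxn_matrix F) (s : steinitz).

(* A sum over [nat] with infinite support is 0 by convention; all the matrices
   considered below have finitely many nonzero entries in each row. *)
Definition nxn_mul A B : nxn_matrix F :=
  fun i j => \sum_(k \in [set: nat]) A i k * B k j.

Definition nxn_one : nxn_matrix F := fun i j => (i == j)%:R.

Definition is_diag_rep n (a : 'M[F]_n) A : Prop :=
  forall (k l : nat) (i j : 'I_n),
    A (k * n + i)%N (l * n + j)%N = if k == l then a i j else 0.

(* For [n = 0] the condition is vacuous; [Mp_n] and [GLp_n] are only used
   with [0 < n]. *)
Definition Mp_n (n : nat) : set (nxn_matrix F) :=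
  [set A | exists a : 'M[F]_n, is_diag_rep a A].

Definition invertible_in (M : set (nxn_matrix F)) : set (nxn_matrix F) :=
  [set A | M A /\
    exists2 B, M B & nxn_mul A B = nxn_one /\ nxn_mul B A = nxn_one].

Definition GLp_n (n : nat) : set (nxn_matrix F) := invertible_in (Mp_n n).

Definition pos_divisors s : set nat :=
  [set n | (0 < n)%N /\ steinitz_dvd (steinitz_of_nat n) s].

Definition Mp s : set (nxn_matrix F) := \bigcup_(n in pos_divisors s) Mp_n n.

Definition GLp s : set (nxn_matrix F) := \bigcup_(n in pos_divisors s) GLp_n n.

Lemma pos_divisorsP s n : pos_divisors s n <->
  (0 < n)%N /\ forall p r, s p = Some r -> (logn (val p) n <= r)%N.
Proof.
split=> [[n0 [t ->]]|[n0 h]]; split=> //.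
  move=> p r; rewrite /steinitz_mul /steinitz_of_nat /=.
  by case: (t p) => //= b [<-]; exact: leq_addr.
exists (fun p => if s p is Some r then Some (r - logn (val p) n)%N else None).
apply/funext => p; rewrite /steinitz_mul /steinitz_of_nat /=.
by case E: (s p) => [r|//] /=; rewrite subnKC// h.
Qed.

Lemma pos_divisors1 s : pos_divisors s 1%N.
Proof. by apply/pos_divisorsP; split=> // p r _; rewrite logn1. Qed.

Lemma pos_divisors_lcm s m n :
  pos_divisors s m -> pos_divisors s n -> pos_divisors s (lcmn m n).
Proof.
move=> /pos_divisorsP[m0 hm] /pos_divisorsP[n0 hn]; apply/pos_divisorsP.
split=> [|p r e]; first by rewrite lcmn_gt0 m0.
by rewrite logn_lcm// geq_max (hm _ _ e) (hn _ _ e).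
Qed.

Lemma nat_blockP n (i : nat) : (0 < n)%N ->
  exists (k : nat) (u : 'I_n), i = (k * n + u)%N.
Proof.
by move=> n0; exists (i %/ n)%N, (Ordinal (ltn_pmod i n0)); exact: divn_eq.
Qed.

Lemma is_diag_rep_inj n (a : 'M[F]_n) A B : (0 < n)%N ->
  is_diag_rep a A -> is_diag_rep a B -> A = B.
Proof.
move=> n0 hA hB; apply/funext => i; apply/funext => j.
have [k [u ->]] := nat_blockP i n0; have [l [v ->]] := nat_blockP j n0.
by rewrite hA hB.
Qed.

Lemma is_diag_rep1 n : (0 < n)%N -> is_diag_rep (1%:M : 'M[F]_n) nxn_one.
Proof.
move=> n0 k l i j; rewrite /nxn_one mxE.
case: (eqVneq k l) => [->|kl]; first by rewrite eqn_add2l.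
case: eqP => // e; case/eqP: kl; have := congr1 (divn ^~ n) e.
by rewrite !divnMDl// !divn_small// !addn0.
Qed.

Lemma is_diag_rep_mul n (a b : 'M[F]_n) A B : (0 < n)%N ->
  is_diag_rep a A -> is_diag_rep b B -> is_diag_rep (a *m b) (nxn_mul A B).
Proof.
move=> n0 hA hB k l i j; rewrite /nxn_mul mxE.
set r := [seq (k * n + u)%N | u : 'I_n].
have ur : uniq r.
  by rewrite map_inj_uniq ?enum_uniq// => u v /addnI /val_inj.
rewrite (fsbigE r)//; last first.
  move=> x _; have [m [u ->]] := nat_blockP x n0; rewrite hA.
  case: (eqVneq k m) => [<-|_]; last by rewrite mul0r.
  by rewrite (map_f (fun u : 'I_n => (k * n + u)%N)) ?mem_enum.
under eq_bigl do rewrite in_setT.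
rewrite /r big_map big_enum /=; case: ifP => kl.
  by apply: eq_bigr => u _; rewrite hA hB eqxx kl.
by rewrite big1// => u _; rewrite hA hB eqxx kl mulr0.
Qed.

Lemma is_diag_rep_exists n (a : 'M[F]_n) : (0 < n)%N ->
  exists A, is_diag_rep a A.
Proof.
case: n a => // n a _.
exists (fun i j => if (i %/ n.+1 == j %/ n.+1)%N
                   then a (inord (i %% n.+1)) (inord (j %% n.+1)) else 0).
move=> k l i j; rewrite !divnMDl// !divn_small// !addn0 !modnMDl !modn_small//.
by rewrite !inord_val.
Qed.

Lemma Mp_n_dvd n m A : (0 < m)%N -> (n %| m)%N -> Mp_n n A -> Mp_n m A.
Proof.
move=> m0 /dvdnP[d em] [a hA].
have n0 : (0 < n)%N by move: m0; rewrite em muln_gt0 => /andP[].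
exists (\matrix_(i < m, j < m) A i j) => k l i j; rewrite mxE.
have [q [u ei]] := nat_blockP i n0; have [q' [v ej]] := nat_blockP j n0.
have qd : (q < d)%N.
  have : (q * n < d * n)%N by rewrite -em; apply: leq_ltn_trans (ltn_ord i); rewrite ei leq_addr.
  by rewrite ltn_pmul2r.
have qd' : (q' < d)%N.
  have : (q' * n < d * n)%N by rewrite -em; apply: leq_ltn_trans (ltn_ord j); rewrite ej leq_addr.
  by rewrite ltn_pmul2r.
rewrite ei ej hA.
have -> : (k * m + (q * n + u) = (k * d + q) * n + u)%N by rewrite em; lia.
have -> : (l * m + (q' * n + v) = (l * d + q') * n + v)%N by rewrite em; lia.
rewrite hA; case: (eqVneq k l) => [->|kl]; first by rewrite eqn_add2l.
case: eqP => // e; case/eqP: kl; have := congr1 (divn ^~ d) e.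
have d0 : (0 < d)%N by apply: leq_ltn_trans qd.
by rewrite !divnMDl// !divn_small// !addn0.
Qed.

Lemma Mp_common s A B : Mp s A -> Mp s B ->
  exists n, [/\ pos_divisors s n, Mp_n n A & Mp_n n B].
Proof.
move=> [m sm mA] [n sn nB]; have sl := pos_divisors_lcm sm sn.
exists (lcmn m n); split=> //.
  by apply: Mp_n_dvd mA; [case: sl|exact: dvdn_lcml].
by apply: Mp_n_dvd nB; [case: sl|exact: dvdn_lcmr].
Qed.

Lemma Mp_mul s A B : Mp s A -> Mp s B -> Mp s (nxn_mul A B).
Proof.
move=> sA sB; have [n [sn [a hA] [b hB]]] := Mp_common sA sB.
by exists n => //; exists (a *m b); apply: is_diag_rep_mul => //; case: sn.
Qed.

Lemma Mp_one s : Mp s nxn_one.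
Proof.
exists 1%N; first exact: pos_divisors1.
by exists 1%:M; exact: is_diag_rep1.
Qed.

Lemma Mp_mulA s A B C : Mp s A -> Mp s B -> Mp s C ->
  nxn_mul A (nxn_mul B C) = nxn_mul (nxn_mul A B) C.
Proof.
move=> [n sn nA] [m sm mB] [q sq qC].
have sN := pos_divisors_lcm (pos_divisors_lcm sn sm) sq.
move: (lcmn (lcmn n m) q) sN (dvdn_lcml (lcmn n m) q) (dvdn_lcmr (lcmn n m) q).
move=> N [N0 _] dN dq.
have [a hA] := Mp_n_dvd N0 (dvdn_trans (dvdn_lcml n m) dN) nA.
have [b hB] := Mp_n_dvd N0 (dvdn_trans (dvdn_lcmr n m) dN) mB.
have [c hC] := Mp_n_dvd N0 dq qC.
apply: (is_diag_rep_inj (a := a *m (b *m c))) => //.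
  by do 2?apply: is_diag_rep_mul.
by rewrite mulmxA; do 2?apply: is_diag_rep_mul.
Qed.

Lemma Mp_mul1 s A : Mp s A -> nxn_mul nxn_one A = A.
Proof.
move=> [n [n0 _] [a hA]]; apply: (is_diag_rep_inj (a := a)) => //.
by rewrite -[a]mul1mx; apply: is_diag_rep_mul => //; exact: is_diag_rep1.
Qed.

Lemma Mp_mulr1 s A : Mp s A -> nxn_mul A nxn_one = A.
Proof.
move=> [n [n0 _] [a hA]]; apply: (is_diag_rep_inj (a := a)) => //.
by rewrite -[a]mulmx1; apply: is_diag_rep_mul => //; exact: is_diag_rep1.
Qed.

Lemma GLp_invertible_in s : GLp s = invertible_in (Mp s).
Proof.
apply/seteqP; split=> A /=.
  by move=> [n sn [nA [B nB AB]]]; split; [exists n|exists B => //; exists n].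
move=> [sA [B sB AB]]; have [n [sn nA nB]] := Mp_common sA sB.
by exists n => //; split=> //; exists B.
Qed.

Lemma GLp_sub s A : GLp s A -> Mp s A.
Proof. by rewrite GLp_invertible_in => -[]. Qed.

Lemma GLp_mul s A B : GLp s A -> GLp s B -> GLp s (nxn_mul A B).
Proof.
rewrite GLp_invertible_in => -[sA [A' sA' [AA' A'A]]] [sB [B' sB' [BB' B'B]]].
split; first exact: Mp_mul.
exists (nxn_mul B' A'); first exact: Mp_mul.
have := Mp_mulA; move=> mA; split.
  rewrite (mA s)//; last exact: Mp_mul.
  by rewrite -(mA s A)// BB' (Mp_mulr1 sA).
rewrite (mA s)//; last exact: Mp_mul.
by rewrite -(mA s B')// A'A (Mp_mulr1 sB').
Qed.

Lemma GLp_one s : GLp s nxn_one.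
Proof.
rewrite GLp_invertible_in; split; first exact: Mp_one.
exists nxn_one; first exact: Mp_one.
by rewrite (Mp_mul1 (Mp_one s)).
Qed.

Lemma GLp_inv s A : GLp s A -> exists2 B, GLp s B & nxn_mul B A = nxn_one /\
  nxn_mul A B = nxn_one.
Proof.
by rewrite GLp_invertible_in => -[sA [B sB [AB BA]]]; exists B => //; split=> //; exists A.
Qed.

Definition GLp_group s : Type := {A : nxn_matrix F | A \in GLp s}.

Section GLpGroup.
Variable s : steinitz.

HB.instance Definition _ := [isSub of GLp_group s for @proj1_sig _ _].
HB.instance Definition _ := gen_eqMixin (GLp_group s).
HB.instance Definition _ := gen_choiceMixin (GLp_group s).

Lemma GLp_groupP (x : GLp_group s) : GLp s (val x).
Proof. by have /set_mem := valP x. Qed.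

Definition GLp_group_one : GLp_group s := exist _ nxn_one (mem_set (GLp_one s)).

Definition GLp_group_mul (x y : GLp_group s) : GLp_group s :=
  exist _ (nxn_mul (val x) (val y))
    (mem_set (GLp_mul (GLp_groupP x) (GLp_groupP y))).

Lemma GLp_group_inv_exists (x : GLp_group s) : exists y : GLp_group s,
  GLp_group_mul y x = GLp_group_one /\ GLp_group_mul x y = GLp_group_one.
Proof.
have [B sB [BA AB]] := GLp_inv (GLp_groupP x).
by exists (exist _ B (mem_set sB)); split; apply/val_inj.
Qed.

Definition GLp_group_inv (x : GLp_group s) : GLp_group s :=
  projT1 (cid (GLp_group_inv_exists x)).

Lemma GLp_group_mulA : associative GLp_group_mul.
Proof.
by move=> x y z; apply/val_inj/(@Mp_mulA s); exact/GLp_sub/GLp_groupP.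
Qed.

Lemma GLp_group_mul1 : left_id GLp_group_one GLp_group_mul.
Proof. by move=> x; apply/val_inj/(@Mp_mul1 s)/GLp_sub/GLp_groupP. Qed.

Lemma GLp_group_mulr1 : right_id GLp_group_one GLp_group_mul.
Proof. by move=> x; apply/val_inj/(@Mp_mulr1 s)/GLp_sub/GLp_groupP. Qed.

Lemma GLp_group_mulV : left_inverse GLp_group_one GLp_group_inv GLp_group_mul.
Proof. by move=> x; rewrite /GLp_group_inv; case: cid => y []. Qed.

Lemma GLp_group_mulrV : right_inverse GLp_group_one GLp_group_inv GLp_group_mul.
Proof. by move=> x; rewrite /GLp_group_inv; case: cid => y []. Qed.

HB.instance Definition _ := isGroup.Build (GLp_group s) GLp_group_mulA
  GLp_group_mul1 GLp_group_mulr1 GLp_group_mulV GLp_group_mulrV.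

End GLpGroup.
End PeriodicMatrices.

Section CommutatorSubgroup.
Variable G : groupType.

Definition commutator_subgroup : set G :=
  smallest [set H : set G | group_closed (mem H)]
    [set z : G | exists x y : G, z = [~ x, y]%g].

Lemma commutator_subgroup_closed : group_closed (mem commutator_subgroup).
Proof.
split=> [|x y]; first by apply/mem_set => H [[/set_mem]].
move=> /set_mem hx /set_mem hy; apply/mem_set => H hH.
by apply: set_mem; apply: hH.1.2; apply: mem_set; [apply: hx|apply: hy].
Qed.

Definition derived_group : Type := {x : G | x \in commutator_subgroup}.

HB.instance Definition _ := [isSub of derived_group for @proj1_sig _ _].
HB.instance Definition _ := [Choice of derived_group by <:].
HB.instance Definition _ := SubChoice_isSubGroup.Build G
  (fun x => x \in commutator_subgroup) derived_group commutator_subgroup_closed.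

End CommutatorSubgroup.

Definition SLp_group (F : fieldType) (s : steinitz) : groupType :=
  derived_group (GLp_group F s).

Definition isomorphic (G H : groupType) : Prop :=
  exists f : {multiplicative G -> H}, bijective f.

(* Main.v *)
(* If [SL_s1] and [SL_s2] are isomorphic, every [k] dividing [s1] divides [s2].
   Enlarge [k] to a divisor [n] of [s1] such that either [n] carries the whole
   finite 2-part of [s1], or [n] is even and the 2-part of [s1] is infinite.
   The [n]-periodic diagonal sign matrices in [SL_s1] form an elementary abelian
   2-group [B], namely the patterns [w] of [n] signs with an even number of -1 in
   the first case and all patterns in the second.  It is normalized by an
   element [c] permuting the [n] signs cyclically, and it is its own "involutive
   bicommutant": an involution commuting with the centralizer of [B] lies in [B].
   All this is transported to [SL_s2].  There the image of [B] lies in some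
   [M_N] with [N] dividing [s2] and is simultaneously diagonalizable; let [T] be
   the set of its joint eigencharacters and [d x] the dimension of the
   eigenspace of [x].  The image of [c] induces a permutation of [T] preserving
   [d], and by the bicommutant property the image of [B] consists of all sign
   patterns on [T] of determinant 1.  Counting these patterns and those fixed
   by the cyclic permutation on both sides forces [T] to be a single orbit
   with [n] elements, so that [n] divides [N].  For even [n] the count needs [N]
   to be even; this is possible because the image of -1 is a central involution
   of [SL_s2], hence equal to -1. *)

Require Import Defs.
From HB Require Import structures.
From mathcomp Require Import all_classical.
From mathcomp Require Import all_boot all_order all_fingroup all_algebra.
From mathcomp Require Import zify ring.

Set Implicit Arguments.
Unset Strict Implicit.
Unset Printing Implicit Defensive.

Import GRing.Theory.

(** * Even sign patterns *)

Section EvenPatterns.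
Variables (T : finType) (d : T -> nat).

(* For a diagonal matrix whose sign [(-1) ^ f x] is repeated [d x] times, this
   says that the determinant is 1. *)
Definition even_patterns : {set {ffun T -> bool}} :=
  [set f : {ffun T -> bool} | ~~ odd (\sum_x f x * d x)].

Lemma card_even_patterns_even : (forall x, ~~ odd (d x)) ->
  #|even_patterns| = 2 ^ #|T|.
Proof.
move=> d_even; rewrite -card_bool -card_ffun -cardsT; apply: eq_card => f.
rewrite !inE; elim/big_ind: _ => // [a b|x _]; first by rewrite oddD => /negPf-> /negPf->.
by rewrite oddM negb_and d_even orbT.
Qed.

(** Toggling the sign at [x0] changes the parity of the weight, so it exchanges [even_patterns] with
    its complement: exactly half of all patterns are even. *)
Lemma card_even_patterns_odd x0 : odd (d x0) ->
  #|even_patterns| = 2 ^ #|T|.-1.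
Proof.
move=> d_odd.
pose toggle (f : {ffun T -> bool}) := [ffun x => f x (+) (x == x0)].
have toggleK : involutive toggle.
  by move=> f; apply/ffunP => x; rewrite !ffunE addbK.
have toggle_even f : (toggle f \in even_patterns) = (f \notin even_patterns).
  rewrite !inE; congr (~~ _).
  rewrite (bigD1 x0)//= [in RHS](bigD1 x0)//= !ffunE eqxx addbT.
  rewrite (eq_bigr (fun x => f x * d x)) => [|x /negPf xx0]; last first.
    by rewrite ffunE xx0 addbF.
  by rewrite !oddD !oddM d_odd !andbT !oddb; case: (f x0) => //=; case: (odd _).
have cardC : #|even_patterns| = #|~: even_patterns|.
  rewrite -(card_imset _ (inv_inj toggleK)); apply: eq_card => f.
  rewrite inE; apply/imsetP/idP => [[g ge ->]|fe].
    by rewrite toggle_even ge.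
  by exists (toggle f); rewrite ?toggleK// toggle_even.
have := cardsC even_patterns; rewrite -cardC addnn card_ffun card_bool.
have : 0 < #|T| by apply/card_gt0P; exists x0.
by case: #|T| => // k _; rewrite expnS mul2n => /double_inj.
Qed.

End EvenPatterns.

Definition pull (T : finType) (s : T -> T) (f : {ffun T -> bool}) :
  {ffun T -> bool} := [ffun x => f (s x)].

Local Notation shift := (pull (@ordS _)).

Lemma pull_even_patterns (T : finType) (d : T -> nat) (s : T -> T) f :
  injective s -> (forall x, d (s x) = d x) ->
  (pull s f \in even_patterns d) = (f \in even_patterns d).
Proof.
move=> s_inj ds; rewrite !inE [in RHS](reindex_inj s_inj)/=.
by under eq_bigr do rewrite ffunE -ds.
Qed.

Lemma iter_ordS n (i : 'I_n) k : iter k (@ordS n) i = (i + k) %% n :> nat.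
Proof.
elim: k => [|k IHk] /=; first by rewrite addn0 modn_small.
by rewrite IHk -addn1 modnDml addn1 addnS.
Qed.

Lemma pull_ordS_const n (w : {ffun 'I_n -> bool}) :
  pull (@ordS n) w = w -> forall i j, w i = w j.
Proof.
move=> sw; have iterw k i : w (iter k (@ordS n) i) = w i.
  elim: k i => // k IHk i; rewrite iterSr IHk.
  by move/ffunP/(_ i): sw; rewrite ffunE.
(* Going [n - i + j] steps forward from [i] wraps around once and ends at [j]. *)
move=> i j; rewrite -(iterw (n - i + j) i); congr (w _); apply/val_inj => /=.
by rewrite iter_ordS addnA subnKC 1?ltnW// modnDl modn_small.
Qed.

(** * Even patterns under a cyclic shift and under a permutation *)

Section EquivariantCount.
Variables (n m : nat) (T : finType) (d : T -> nat) (t : {perm T}).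
Variable h : {ffun 'I_n -> bool} -> {ffun T -> bool}.
Local Notation E := (even_patterns (fun _ : 'I_n => m)).
Local Notation ET := (even_patterns d).
Hypothesis n3 : 2 < n.
Hypothesis n_odd : odd n -> odd m.
Hypothesis d_even : ~~ odd n -> ~~ odd (\sum_x d x).
Hypothesis dt : forall x, d (t x) = d x.
Hypothesis h_inj : {in E &, injective h}.
Hypothesis h_im : h @: E = ET.
Hypothesis ht : {in E, forall w, h (pull (@ordS n) w) = pull t (h w)}.

Let cst b : {ffun 'I_n -> bool} := [ffun=> b].
Let ind (A : {set T}) : {ffun T -> bool} := [ffun x => x \in A].

Let pullE w : (pull (@ordS n) w \in E) = (w \in E).
Proof. by apply: pull_even_patterns => //; exact: ordS_inj. Qed.

Let indE (A : {set T}) : (ind A \in ET) = ~~ odd (\sum_(x in A) d x).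
Proof.
rewrite inE [in RHS]big_mkcond/=; congr (~~ odd _); apply: eq_bigr => x _.
by rewrite ffunE; case: (x \in A); rewrite ?mul1n ?mul0n.
Qed.

Let fixed_cst f : f \in ET -> pull t f = f -> exists2 b, cst b \in E & f = h (cst b).
Proof.
rewrite -h_im => /imsetP[w wE ->]; rewrite -ht// => /h_inj.
rewrite pullE => /(_ wE wE)/pull_ordS_const w_cst.
have w0 : cst (w (Ordinal (ltnW (ltnW n3)))) = w.
  by apply/ffunP => i; rewrite ffunE; apply: w_cst.
by exists (w (Ordinal (ltnW (ltnW n3)))); rewrite w0.
Qed.

Let pull_ind (A : {set T}) : t @^-1: A = A -> pull t (ind A) = ind A.
Proof.
by move=> tA; apply/ffunP => x; rewrite !ffunE -[in RHS]tA inE.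
Qed.

Let ind_inj : injective ind.
Proof. by move=> A B /ffunP AB; apply/setP => x; have := AB x; rewrite !ffunE. Qed.

Let sum0 (f : T -> nat) : ~~ odd (\sum_(x in set0) f x).
Proof. by rewrite big_pred0// => x; rewrite inE. Qed.

(* A fixed pattern of [ET] comes from a constant pattern of [E]: there is only
   one of them for odd [n], and two for even [n]. *)
Let invariant_odd (A : {set T}) : odd n -> t @^-1: A = A -> ~~ odd (\sum_(x in A) d x) ->
  A = set0.
Proof.
move=> no tA Ae; apply: ind_inj.
have key (B : {set T}) : t @^-1: B = B -> ~~ odd (\sum_(x in B) d x) -> ind B = h (cst false).
  move=> tB; rewrite -indE => /fixed_cst/(_ (pull_ind tB))[[|]// + _].
  (* The constant pattern [true] has weight [n * m], a product of odd numbers, so it is not in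
     [E]. *)
  rewrite inE; under eq_bigr do rewrite ffunE mul1n.
  by rewrite sum_nat_const card_ord oddM no n_odd.
by rewrite !key//; apply/setP => x; rewrite !inE.
Qed.

Let invariant_even (A : {set T}) : ~~ odd n -> t @^-1: A = A ->
  ~~ odd (\sum_(x in A) d x) -> A = set0 \/ A = setT.
Proof.
move=> ne tA Ae.
have key (B : {set T}) : t @^-1: B = B -> ~~ odd (\sum_(x in B) d x) ->
    exists b, ind B = h (cst b).
  by move=> tB; rewrite -indE => /fixed_cst/(_ (pull_ind tB))[b _]; exists b.
have t0 : t @^-1: set0 = set0 by apply/setP => x; rewrite !inE.
have tT : t @^-1: setT = setT by apply/setP => x; rewrite !inE.
have Te : ~~ odd (\sum_(x in setT) d x).
  by rewrite (eq_bigl xpredT) ?d_even// => x; rewrite inE.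
have [[a ea] [b eb] [c ec]] := And3 (key _ tA Ae) (key _ t0 (sum0 _)) (key _ tT Te).
case: (eqVneq a b) => [ab|ab]; first by left; apply: ind_inj; rewrite ea eb ab.
case: (eqVneq a c) => [ac|ac]; first by right; apply: ind_inj; rewrite ea ec ac.
(* Both booleans differ from [a], so they agree; then [set0 = setT], and [A] is empty too. *)
have bc : b = c by move: ab ac; case: a {ea}; case: b {eb}; case: c {ec}.
have : set0 = setT :> {set T} by apply: ind_inj; rewrite eb bc ec.
by move/setP => eT; left; apply/setP => x; have := eT x; rewrite !inE.
Qed.

(* The pattern supported on [0] and [j] is moved by an odd power of the shift
   as soon as [j] is neither [0] nor the image of [0]. *)
Let shift_even k : ~~ odd n -> (forall x, iter k t x = x) -> ~~ odd k.
Proof.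
move=> ne tk; apply/negP => ko.
have iterh w : w \in E -> h (iter k (pull (@ordS n)) w) = iter k (pull t) (h w) /\
    iter k (pull (@ordS n)) w \in E.
  move=> wE; elim: k {tk ko} => //= k [IHk IHE].
  by rewrite ht// IHk pullE.
have iterpull (S : finType) (s : S -> S) w x : iter k (pull s) w x = w (iter k s x).
  by elim: k x {tk ko iterh} => //= k IHk x; rewrite ffunE IHk -iterS iterSr.
have w_inv w : w \in E -> forall i, w (iter k (@ordS n) i) = w i.
  move=> wE i; rewrite -iterpull; congr (fun_of_fin _ _); apply: h_inj => //.
    by case: (iterh w wE).
  by rewrite (iterh w wE).1; apply/ffunP => x; rewrite iterpull tk.
have [i0 e0] : exists i : 'I_n, i = 0 :> nat by exists (Ordinal (ltnW (ltnW n3))).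
have [j [j0 jk]] : exists j : 'I_n, j != i0 /\ j != iter k (@ordS n) i0.
  (* One of [1] and [2] always serves, and [2] is an index because [2 < n]. Two minus signs form an
     even pattern whatever [m] is. *)
  exists (if (k %% n) == 1 then Ordinal n3 else Ordinal (ltnW n3)).
  by case: ifP => e; split; rewrite -val_eqE/= ?iter_ordS ?e0 ?add0n// ?(eqP e)// eq_sym e.
have := w_inv [ffun i => (i == i0) || (i == j)]; rewrite inE.
rewrite (bigD1 i0)//= (bigD1 j)//= !ffunE eqxx eqxx orbT !mul1n.
rewrite big1 => [|i /andP[i1 i2]]; last by rewrite ffunE (negPf i1) (negPf i2).
rewrite addn0 addnn odd_double => /(_ isT)/(_ i0); rewrite !ffunE eqxx/=.
rewrite [_ == j]eq_sym (negPf jk) orbF => /eqP/(congr1 val)/=.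
rewrite iter_ordS e0 add0n => /eqP; rewrite -/(n %| k) => nk.
by move: ne; rewrite (dvdn_odd nk).
Qed.

Let porbit_inv x : t @^-1: porbit t x = porbit t x.
Proof.
apply/setP => y; rewrite inE porbit_sym [RHS]porbit_sym.
by have := porbit_perm t 1 y; rewrite expg1 => ->.
Qed.

Let d_porbit x y : y \in porbit t x -> d y = d x.
Proof.
case/porbitP => i ->; rewrite permX.
by elim: i => //= i IHi; rewrite dt.
Qed.

Let sum_porbit x : \sum_(y in porbit t x) d y = #|porbit t x| * d x.
Proof.
rewrite -sum_nat_const; apply: eq_bigr => y yx.
exact: d_porbit.
Qed.

(** An orbit is invariant and has weight [#|porbit t x| * d x]. Were this even, the orbit would be
    empty or all of [T], but it contains [x] and misses [y]. *)
Let porbit_odd x y : y \notin porbit t x -> odd #|porbit t x| && odd (d x).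
Proof.
move=> yx; rewrite -oddM -sum_porbit.
apply: contraT => xe; have x0 := porbit_id t x.
case/boolP: (odd n) => [no|ne].
  by move: x0; rewrite (invariant_odd no (porbit_inv x) xe) inE.
case: (invariant_even ne (porbit_inv x) xe) => e.
  by move: x0; rewrite e inE.
by move: yx; rewrite e inE.
Qed.

(* Orbits other than [T] are odd sets, so two of them have an even union, which
   is all of [T]; then an odd power of [t] is trivial. *)
Let porbitT x : porbit t x = setT.
Proof.
apply/setP => y; rewrite inE; apply: contraT => yx.
have xy : x \notin porbit t y by rewrite porbit_sym.
have dis : [disjoint porbit t x & porbit t y].
  apply/pred0P => z /=; apply/negP => /andP[]; rewrite -!eq_porbit_mem.
  by move=> /eqP zx /eqP zy; move: yx; rewrite porbit_sym -eq_porbit_mem -zx zy eqxx.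
have [/andP[ox dx] /andP[oy dy]] := (porbit_odd yx, porbit_odd xy).
have Ue : ~~ odd (\sum_(z in porbit t x :|: porbit t y) d z).
  rewrite (eq_bigl [predU porbit t x & porbit t y]) => [|z]; last by rewrite !inE.
  by rewrite bigU//= !sum_porbit oddD !oddM ox dx oy dy.
have tU : t @^-1: (porbit t x :|: porbit t y) = porbit t x :|: porbit t y.
  by rewrite preimsetU !porbit_inv.
have xU : x \in porbit t x :|: porbit t y by rewrite inE porbit_id.
case/boolP: (odd n) => [no|ne].
  by move: xU; rewrite (invariant_odd no tU Ue) inE.
case: (invariant_even ne tU Ue) => e; first by move: xU; rewrite e inE.
suff : ~~ odd (#|porbit t x| * #|porbit t y|) by rewrite oddM ox oy.
apply: shift_even => // z.
have : z \in porbit t x :|: porbit t y by rewrite e inE.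
have iterM a b : iter a t z = z -> iter (b * a) t z = z.
  by move=> az; elim: b => // b IHb; rewrite mulSn iterD IHb.
case/setUP; rewrite -eq_porbit_mem => /eqP<-; last exact/iterM/iter_porbit.
by rewrite mulnC; exact/iterM/iter_porbit.
Qed.

(* Both pattern sets have equally many elements, so [#|T|] and [n] differ by at
   most one, and the parity of [#|T|] settles the matter. *)
Lemma dvdn_sum_weights : n %| \sum_x d x.
Proof.
have [T0|/card_gt0P[x _]] := posnP #|T|.
  by rewrite big1 ?dvdn0// => x; move: T0 => /card0_eq/(_ x).
have sumT : \sum_x d x = #|T| * d x.
  rewrite -cardsT -(porbitT x) -sum_porbit.
  by apply: eq_bigl => y; rewrite (porbitT x) inE.
have Te : ~~ odd n -> ~~ odd #|T|.
  (* As [T] is a single orbit, the power [#|T|] of [t] is trivial. *)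
  move=> ne; apply: (shift_even ne) => y.
  by rewrite -cardsT -(porbitT y) iter_porbit.
have To : odd n -> odd #|T| && odd (d x).
  (* If the total weight were even, [T] itself would be an invariant set of even weight, hence
     empty. *)
  move=> no; rewrite -oddM -sumT; apply: contraT => e.
  have := @invariant_odd setT no; rewrite -(porbitT x) sum_porbit porbitT cardsT -sumT.
  rewrite -{1 2}(porbitT x) porbit_inv => /(_ erefl e) /setP/(_ x).
  by rewrite !inE.
have cardE : #|ET| = #|E| by rewrite -h_im card_in_imset.
have T0 : 0 < #|T| by apply/card_gt0P; exists x.
have cT : #|ET| = 2 ^ (#|T| - odd (d x)).
  case: (boolP (odd (d x))) => dx; first by rewrite (card_even_patterns_odd dx) subn1.
  rewrite subn0 card_even_patterns_even// => y.
  by rewrite (@d_porbit x)// porbitT inE.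
have cE : #|E| = 2 ^ (n - odd m).
  case: (boolP (odd m)) => mo; last by rewrite subn0 card_even_patterns_even ?card_ord.
  by rewrite (@card_even_patterns_odd _ _ (Ordinal n3)) ?card_ord ?subn1.
have /eqP : 2 ^ (#|T| - odd (d x)) = 2 ^ (n - odd m) by rewrite -cT cardE cE.
rewrite eqn_exp2l// sumT => e; suff -> : #|T| = n by rewrite dvdn_mulr.
have n0 : 0 < n by exact: leq_trans n3.
move: e; case/boolP: (odd n) => [no|ne].
  have /andP[_ ->] := To no; rewrite (n_odd no) !subn1 => /eqP/(congr1 succn).
  by rewrite !prednK.
have := Te ne; rewrite -(prednK T0) -(prednK n0) in ne *.
case: (odd (d x)); case: (odd m); rewrite ?subn1 ?subn0 /= => oT /eqP e.
- by rewrite e.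
- by move: oT ne; rewrite /= e /= negbK => ->.
- by move: oT ne; rewrite /= -e /= !negbK => ->.
by [].
Qed.

End EquivariantCount.

Local Open Scope ring_scope.

(** * Generation of the special linear group *)

Section SpecialLinear.
Variable F : fieldType.

Definition transvection n (i j : 'I_n) (x : F) : 'M[F]_n :=
  1%:M + x *: delta_mx i j.

Lemma transvectionM n (i j : 'I_n) x y : i != j ->
  transvection i j x *m transvection i j y = transvection i j (x + y).
Proof.
move=> ij; rewrite mulmxDl !mulmxDr !mul1mx mulmx1 -scalemxAl -scalemxAr.
rewrite mul_delta_mx_cond eq_sym (negPf ij) mulr0n !scaler0 addr0.
by rewrite -addrA -scalerDl [y + x]addrC.
Qed.

Lemma transvection0 n (i j : 'I_n) : transvection i j 0 = 1%:M.
Proof. by rewrite /transvection scale0r addr0. Qed.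

Lemma transvection_unit n (i j : 'I_n) x : i != j ->
  transvection i j x \in unitmx /\
  invmx (transvection i j x) = transvection i j (- x).
Proof.
move=> ij; have e : transvection i j x *m transvection i j (- x) = 1%:M.
  by rewrite transvectionM// subrr transvection0.
have [u _] := mulmx1_unit e; split => //.
by rewrite -[RHS](mulKmx u) e mulmx1.
Qed.

Lemma det_transvection n (i j : 'I_n) x : i != j -> \det (transvection i j x) = 1.
Proof.
move=> ij; wlog ji : i j ij / (j < i)%N => [h|].
  case: (ltngtP j i) => [|lt_ij|e]; [exact: h| |by case/eqP: ij; apply/val_inj].
  rewrite -det_tr (_ : (transvection i j x)^T = transvection j i x).
    by apply: h; rewrite 1?eq_sym.
  by rewrite /transvection linearD linearZ/= trmx_delta trmx1.
rewrite det_trig; last first.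
  apply/is_trig_mxP => k l kl; rewrite !mxE -!val_eqE/=.
  rewrite (ltn_eqF kl); case: eqP => [ki|]; last by rewrite mulr0 addr0.
  by case: eqP => [lj|]; rewrite ?mulr0 ?addr0//; lia.
apply: big1 => k _; rewrite !mxE eqxx.
case: eqP => [->|_]; last by rewrite mulr0 addr0.
by rewrite (negPf ij) mulr0 addr0.
Qed.

Section Induction.
Variables (n : nat) (P : 'M[F]_(1 + n.+1) -> Prop).
Hypothesis P1 : P 1%:M.
Hypothesis PM : forall a b, P a -> P b -> P (a *m b).
Hypothesis PT : forall i j x, i != j -> P (transvection i j x).
Hypothesis IH : forall P' : 'M[F]_n.+1 -> Prop, P' 1%:M ->
  (forall a b, P' a -> P' b -> P' (a *m b)) ->
  (forall i j x, i != j -> P' (transvection i j x)) ->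
  forall a, \det a = 1 -> P' a.

Let lower (c : 'cV[F]_n.+1) : 'M[F]_(1 + n.+1) := block_mx 1%:M 0 c 1%:M.
Let upper (r : 'rV[F]_n.+1) : 'M[F]_(1 + n.+1) := block_mx 1%:M r 0 1%:M.

Let lowerD c c' : lower (c + c') = lower c *m lower c'.
Proof.
by rewrite mulmx_block !mul1mx !mulmx1 !mul0mx !mulmx0 !addr0 add0r.
Qed.

Let upperD r r' : upper (r + r') = upper r *m upper r'.
Proof.
by rewrite mulmx_block !mul1mx !mulmx1 !mul0mx !mulmx0 !addr0 add0r addrC.
Qed.

Let lower_delta i x :
  lower (x *: delta_mx i 0) = transvection (rshift 1 i) (lshift n.+1 0) x.
Proof.
rewrite -[RHS]submxK; congr block_mx; apply/matrixP => a b;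
  rewrite !mxE -!val_eqE /= ?ord1 /= ?add0n ?addr0.
all: rewrite ?eqSS ?andbF ?mulr0 ?addr0 ?add0r //.
Qed.

Let upper_delta i x :
  upper (x *: delta_mx 0 i) = transvection (lshift n.+1 0) (rshift 1 i) x.
Proof.
rewrite -[RHS]submxK; congr block_mx; apply/matrixP => a b;
  rewrite !mxE -!val_eqE /= ?ord1 /= ?add0n ?addr0.
all: rewrite ?eqSS ?andbF ?mulr0 ?addr0 ?add0r //.
Qed.

Let P_lower c : P (lower c).
Proof.
rewrite [c]matrix_sum_delta; elim/big_ind: _ => [|c1 c2 h1 h2|i _].
- by rewrite /lower -scalar_mx_block.
- by rewrite lowerD; apply: PM.
by rewrite big_ord1 lower_delta; apply: PT; rewrite eq_rlshift.
Qed.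

Let P_upper r : P (upper r).
Proof.
rewrite [r]matrix_sum_delta big_ord1; elim/big_ind: _ => [|c1 c2 h1 h2|i _].
- by rewrite /upper -scalar_mx_block.
- by rewrite upperD; apply: PM.
by rewrite upper_delta; apply: PT; rewrite eq_lrshift.
Qed.

Let det_lower c : \det (lower c) = 1.
Proof. by rewrite det_lblock !det1 mulr1. Qed.

Let det_upper r : \det (upper r) = 1.
Proof. by rewrite det_ublock !det1 mulr1. Qed.

(** Gaussian elimination: a corner entry 1 clears its row and column, leaving a block [d] of
    determinant 1. [IH] is applied to the predicate that embeds [d] in a block-diagonal matrix,
    hence its quantification over [P']. *)
Let step_one a : ulsubmx a = 1%:M -> \det a = 1 -> P a.
Proof.
move=> a1; set c := dlsubmx a; set r := ursubmx a.
set d := drsubmx a - c *m r; set b : 'M_(1 + n.+1) := block_mx 1%:M 0 0 d.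
have ea : a = lower c *m b *m upper r.
  rewrite !mulmx_block !mul1mx !mulmx1 !mul0mx !mulmx0 !addr0 !add0r.
  by rewrite addrC subrK -[LHS]submxK a1 mul1mx.
rewrite [in \det a]ea !det_mulmx det_lower det_upper mul1r mulr1 det_lblock det1 mul1r ea => d1.
apply: (PM (PM (P_lower _) _) (P_upper _)).
apply: (IH (P' := fun d => P (block_mx 1%:M 0 0 d))) d1.
- by rewrite -scalar_mx_block.
- move=> x y hx hy; have := PM hx hy.
  by rewrite mulmx_block !mul1mx !mul0mx !mulmx0 !addr0 add0r.
move=> i j x ij; have := @PT (rshift 1 i) (rshift 1 j) x.
rewrite eq_rshift => /(_ ij); congr P.
rewrite -[LHS]submxK; congr block_mx; apply/matrixP => u v;
  rewrite !mxE -!val_eqE /= ?ord1 /= ?add0n ?addr0.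
all: rewrite ?eqSS ?andbF ?mulr0 ?addr0 ?add0r //.
Qed.

Let step_nz (a : 'M[F]_(1 + n.+1)) i : a (rshift 1 i) (lshift n.+1 0) != 0 -> \det a = 1 -> P a.
Proof.
(* Adding [x] times the row of the nonzero entry to the first row turns the corner entry into 1. *)
move=> ai a1; pose x := (1 - a (lshift n.+1 0) (lshift n.+1 0)) / a (rshift 1 i) (lshift n.+1 0).
have -> : a = upper (- (x *: delta_mx 0 i)) *m (upper (x *: delta_mx 0 i) *m a).
  by rewrite mulmxA -upperD addNr /upper -scalar_mx_block mul1mx.
apply: PM => //; apply: step_one; last by rewrite det_mulmx det_upper mul1r.
rewrite upper_delta mulmxDl mul1mx -scalemxAl; apply/matrixP => u v.
rewrite !ord1 !mxE (bigD1 (rshift 1 i))//= big1 => [|k ki]; last first.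
  by rewrite mxE (negPf ki) andbF mul0r.
by rewrite mxE !eqxx mul1r addr0 /x divfK// addrC subrK.
Qed.

(** If the first column vanishes below the corner, the determinant forces the corner entry to be
    nonzero; adding the first row to the second then reduces to [step_nz]. *)
Lemma transvection_ind_step (a : 'M[F]_(1 + n.+1)) : \det a = 1 -> P a.
Proof.
move=> a1; case: (pickP (fun i => a (rshift 1 i) (lshift n.+1 0) != 0)) => [i ai|a0].
  exact: step_nz ai a1.
have a00 : a (lshift n.+1 0) (lshift n.+1 0) != 0.
  apply: contraPneq a1 => a00; rewrite (expand_det_col _ (lshift n.+1 0)) big1.
    by move=> /esym/eqP; rewrite (negPf (oner_neq0 _)).
  move=> k _; case: (split_ordP k) => k' ->; first by rewrite ord1 a00 mul0r.
  by have := a0 k' => /negbFE/eqP->; rewrite mul0r.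
have -> : a = lower (- delta_mx 0 0) *m (lower (delta_mx 0 0) *m a).
  by rewrite mulmxA -lowerD addNr /lower -scalar_mx_block mul1mx.
apply: PM => //; apply: (@step_nz _ 0); last by rewrite det_mulmx det_lower mul1r.
have /negbFE/eqP e0 := a0 0.
rewrite -[delta_mx 0 0]scale1r lower_delta mulmxDl mul1mx scale1r !mxE e0 add0r.
rewrite (bigD1 (lshift n.+1 0))//= big1 => [|k ki]; last first.
  by rewrite mxE (negPf ki) andbF mul0r.
by rewrite mxE !eqxx mul1r addr0.
Qed.

End Induction.

Lemma transvection_ind n (P : 'M[F]_n -> Prop) : P 1%:M ->
  (forall a b, P a -> P b -> P (a *m b)) ->
  (forall i j x, i != j -> P (transvection i j x)) ->
  forall a, \det a = 1 -> P a.
Proof.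
elim: n P => [|[|n] IHn] P P1 PM PT a a1; last exact: transvection_ind_step.
  by rewrite [a]flatmx0 -[0](flatmx0 1%:M).
have -> // : a = 1%:M.
by rewrite [a]mx11_scalar -[a 0 0]det_mx11 a1.
Qed.

Hypothesis char_neq2 : 2%N \notin [pchar F].

Lemma two_neq0 : 2%:R != 0 :> F.
Proof. by move: char_neq2; rewrite inE. Qed.

(** Transvections generate, and each is a commutator: conjugation by a diagonal reflection inverts
    the transvection with coefficient [- (x / 2)], so the commutator of the two has coefficient
    [x]. *)
Lemma SL_ind n (P : 'M[F]_n -> Prop) : P 1%:M ->
  (forall a b, P a -> P b -> P (a *m b)) ->
  (forall g h, g \in unitmx -> h \in unitmx ->
     P (g *m h *m invmx g *m invmx h)) ->
  forall a, \det a = 1 -> P a.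
Proof.
move=> P1 PM PC; apply: transvection_ind => // i j x ij.
(* [g] negates the [i]-th coordinate, hence inverts the transvection. *)
pose g : 'M[F]_n := 1%:M - 2%:R *: delta_mx i i.
have ED : delta_mx i j *m delta_mx i i = 0 :> 'M[F]_n.
  by rewrite mul_delta_mx_cond eq_sym (negPf ij).
have gE k : g *m delta_mx i k = - delta_mx i k.
  rewrite mulmxBl mul1mx -scalemxAl mul_delta_mx scaler_nat mulr2n.
  by rewrite opprD addrA subrr sub0r.
have Eg : delta_mx i j *m g = delta_mx i j.
  by rewrite mulmxBr mulmx1 -scalemxAr ED scaler0 subr0.
have gT y : g *m transvection i j y = transvection i j (- y) *m g.
  rewrite /transvection [LHS]mulmxDr [RHS]mulmxDl mulmx1 mul1mx -scalemxAr -scalemxAl gE Eg.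
  by rewrite scalerN scaleNr.
have gg : g *m g = 1%:M.
  by rewrite {2}/g mulmxBr mulmx1 -scalemxAr gE scalerN opprK subrK.
have [gU _] := mulmx1_unit gg.
have gV : invmx g = g by rewrite -[RHS](mulKmx gU) gg mulmx1.
have [hU hV] := transvection_unit (- (x / 2%:R)) ij.
have := PC _ _ gU hU; rewrite gV hV gT -[_ *m g *m g]mulmxA gg mulmx1 !opprK.
by rewrite transvectionM// -mulr2n -[_ *+ 2]mulr_natr divfK// two_neq0.
Qed.

End SpecialLinear.

(** * Periodic matrices of determinant one *)

Section Reps.
Variable F : fieldType.
Implicit Types (A B : nxn_matrix F) (s : steinitz).

Definition nxn_diag (d : nat -> F) : nxn_matrix F := fun i j => if i == j then d i else 0.

(** For an [n]-periodic matrix this is the repeated block, obtained as a function instead of through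
    the existential in [Mp_n]. *)
Definition corner n A : 'M[F]_n := \matrix_(i, j) A i j.

Lemma is_diag_rep_corner n (a : 'M[F]_n) A : is_diag_rep a A -> corner n A = a.
Proof.
by move=> aA; apply/matrixP => i j; have := aA 0%N 0%N i j; rewrite !mxE.
Qed.

Lemma Mp_n_corner n A : Mp_n n A -> is_diag_rep (corner n A) A.
Proof. by case=> a aA; rewrite (is_diag_rep_corner aA). Qed.

Lemma Mp_n_mul n A B : (0 < n)%N -> Mp_n n A -> Mp_n n B -> Mp_n n (nxn_mul A B).
Proof. by move=> n0 [a aA] [b bB]; exists (a *m b); exact: is_diag_rep_mul. Qed.

Lemma corner_mul n A B : (0 < n)%N -> Mp_n n A -> Mp_n n B ->
  corner n (nxn_mul A B) = corner n A *m corner n B.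
Proof.
move=> n0 nA nB; apply: is_diag_rep_corner.
by apply: is_diag_rep_mul => //; exact: Mp_n_corner.
Qed.

Lemma corner_one n : (0 < n)%N -> corner n (nxn_one F) = 1%:M.
Proof. by move=> n0; apply: is_diag_rep_corner; exact: is_diag_rep1. Qed.

Lemma corner_inj n A B : (0 < n)%N -> Mp_n n A -> Mp_n n B ->
  corner n A = corner n B -> A = B.
Proof.
move=> n0 nA nB AB; apply: (is_diag_rep_inj n0 (Mp_n_corner nA)).
by rewrite AB; exact: Mp_n_corner.
Qed.

Lemma nxn_diag_rep n (d : nat -> F) : (0 < n)%N -> (forall i, d i = d (i %% n)%N) ->
  is_diag_rep (diag_mx (\row_(i < n) d i)) (nxn_diag d).
Proof.
move=> n0 dn k l i j; rewrite /nxn_diag !mxE.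
have -> : (k * n + i == l * n + j)%N = (k == l) && (i == j).
  apply/eqP/andP => [e|[/eqP-> /eqP->]//].
  have := congr1 (divn ^~ n) e; have := congr1 (modn ^~ n) e.
  rewrite !modnMDl !modn_small// => /val_inj ->.
  by rewrite !divnMDl// !divn_small// !addn0 => ->; rewrite !eqxx.
case: (k == l) => //=; rewrite dn modnMDl modn_small//.
by case: (i == j); rewrite ?mulr1n ?mulr0n.
Qed.

Definition sl_at n A := Mp_n n A /\ \det (corner n A) = 1.

Lemma sl_at_rep n (a : 'M[F]_n) : (0 < n)%N -> \det a = 1 ->
  exists2 A, sl_at n A & corner n A = a.
Proof.
move=> n0 a1; have [A aA] := is_diag_rep_exists a n0.
by exists A; rewrite /sl_at (is_diag_rep_corner aA) //; split=> //; exists a.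
Qed.

Hypothesis char_neq2 : 2%N \notin [pchar F].

(* The determinant of the [m]-periodic block is a power of that of the [n]-periodic
   one; it is enough to know that it is 1 on commutators. *)
Lemma sl_at_dvd n m A : (0 < n)%N -> (0 < m)%N -> (n %| m)%N ->
  sl_at n A -> sl_at m A.
Proof.
move=> n0 m0 nm [nA dA]; split; first exact: Mp_n_dvd nA.
have up B : Mp_n n B -> Mp_n m B by exact: Mp_n_dvd.
suff H (a : 'M[F]_n) : \det a = 1 -> forall B, is_diag_rep a B -> \det (corner m B) = 1.
  by apply: (H (corner n A)) => //; exact: Mp_n_corner.
move: a; apply: SL_ind => // [B hB|a b ha hb B hB|g h gU hU B hB].
- by rewrite (is_diag_rep_inj n0 hB (is_diag_rep1 _ n0)) corner_one// det1.
- have [A1 hA1] := is_diag_rep_exists a n0; have [A2 hA2] := is_diag_rep_exists b n0.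
  rewrite (is_diag_rep_inj n0 hB (is_diag_rep_mul n0 hA1 hA2)).
  rewrite corner_mul//; [|by apply: up; exists a|by apply: up; exists b].
  by rewrite det_mulmx ha// hb// mulr1.
have [G hG] := is_diag_rep_exists g n0; have [H hH] := is_diag_rep_exists h n0.
have [G' hG'] := is_diag_rep_exists (invmx g) n0.
have [H' hH'] := is_diag_rep_exists (invmx h) n0.
have hGH := is_diag_rep_mul n0 hG hH; have hGHG := is_diag_rep_mul n0 hGH hG'.
have hc := is_diag_rep_mul n0 hGHG hH'.
rewrite (is_diag_rep_inj n0 hB hc).
have inv1 x y X Y : is_diag_rep x X -> is_diag_rep y Y -> x *m y = 1%:M :> 'M_n ->
    \det (corner m X) * \det (corner m Y) = 1.
  move=> hX hY xy; rewrite -det_mulmx -corner_mul//; [|by apply: up; exists x|by apply: up; exists y].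
  have := is_diag_rep_mul n0 hX hY; rewrite xy => hXY.
  by rewrite (is_diag_rep_inj n0 hXY (is_diag_rep1 _ n0)) corner_one// det1.
rewrite !corner_mul ?det_mulmx//; try by apply: up; eexists; eassumption.
have e1 := inv1 _ _ _ _ hG hG' (mulmxV gU).
have e2 := inv1 _ _ _ _ hH hH' (mulmxV hU).
transitivity (\det (corner m G) * \det (corner m G') *
  (\det (corner m H) * \det (corner m H'))); first by ring.
by rewrite e1 e2 mulr1.
Qed.

Lemma pos_divisors_dvd s n m : (n %| m)%N -> pos_divisors s m -> pos_divisors s n.
Proof.
move=> nm /pos_divisorsP[m0 hm]; apply/pos_divisorsP.
split=> [|p r pr]; first exact: dvdn_gt0 nm.
exact: leq_trans (dvdn_leq_log _ m0 nm) (hm _ _ pr).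
Qed.

End Reps.

(** * The commutator subgroup as the matrices of determinant one *)

Section SLp.
Variables (F : fieldType) (s : steinitz).
Hypothesis char_neq2 : 2%N \notin [pchar F].

Definition mat (g : SLp_group F s) : nxn_matrix F := val (val g).

Lemma matM g h : mat (g * h)%g = nxn_mul (mat g) (mat h).
Proof. by []. Qed.

Lemma mat1 : mat 1%g = @nxn_one F.
Proof. by []. Qed.

Lemma mat_inj : injective mat.
Proof. by move=> g h /val_inj/val_inj. Qed.

Lemma GLp_level (x : GLp_group F s) :
  exists n, [/\ pos_divisors s n, Mp_n n (val x) & Mp_n n (val x^-1%g)].
Proof. by apply: Mp_common; exact/GLp_sub/GLp_groupP. Qed.

Lemma GLp_level_dvd (x : GLp_group F s) n m : pos_divisors s m -> (n %| m)%N ->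
  Mp_n n (val x) -> Mp_n m (val x).
Proof. by move=> sm; apply: Mp_n_dvd; case: sm. Qed.

Lemma corner_GLpV (x : GLp_group F s) n : pos_divisors s n ->
  Mp_n n (val x) -> Mp_n n (val x^-1%g) ->
  \det (corner n (val x)) * \det (corner n (val x^-1%g)) = 1.
Proof.
move=> sn nx ny; have n0 := sn.1.
rewrite -det_mulmx -corner_mul// -(det1 _ n) -(corner_one _ n0).
by congr (\det (corner _ _)); exact: (congr1 val (mulgV x)).
Qed.

(** By minimality of the commutator subgroup it is enough that the elements of determinant 1 at some
    level form a subgroup and that, at a common level, the determinants in a commutator cancel. *)
Lemma SLp_sl_at g : exists2 n, pos_divisors s n & sl_at n (mat g).
Proof.
pose H : set (GLp_group F s) := fun x => exists2 n, pos_divisors s n & sl_at n (val x).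
have /(_ H) := set_mem (valP g); apply; split=> /=.
  split=> [|x y]; first by apply/mem_set; exists 1%N; [exact: pos_divisors1|];
    split; [exists 1%:M; exact: is_diag_rep1|rewrite corner_one// det1].
  move=> /set_mem[n sn nx] /set_mem[m sm my]; apply/mem_set.
  have [k [sk ky kyV]] := GLp_level y.
  have sN := pos_divisors_lcm (pos_divisors_lcm sn sm) sk.
  move: (lcmn (lcmn n m) k) sN (dvdn_lcml (lcmn n m) k) (dvdn_lcmr (lcmn n m) k).
  move=> N sN nmN kN; have N0 := sN.1; exists N => //.
  have [NX dX] := sl_at_dvd char_neq2 sn.1 N0 (dvdn_trans (dvdn_lcml n m) nmN) nx.
  have [NY dY] := sl_at_dvd char_neq2 sm.1 N0 (dvdn_trans (dvdn_lcmr n m) nmN) my.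
  have NYV := GLp_level_dvd sN kN kyV.
  split; first exact: Mp_n_mul.
  rewrite corner_mul// det_mulmx dX mul1r.
  by have := corner_GLpV sN NY NYV; rewrite dY mul1r.
move=> z [x [y ->]].
have [n [sn nx nxV]] := GLp_level x; have [m [sm my myV]] := GLp_level y.
have sN := pos_divisors_lcm sn sm; have N0 := sN.1; exists (lcmn n m) => //.
have up1 w := @GLp_level_dvd w _ _ sN (dvdn_lcml n m).
have up2 w := @GLp_level_dvd w _ _ sN (dvdn_lcmr n m).
move: (lcmn n m) sN N0 up1 up2 => N sN N0 up1 up2.
have [Nx NxV Ny NyV] := And4 (up1 _ nx) (up1 _ nxV) (up2 _ my) (up2 _ myV).
split; first by do !apply: Mp_n_mul => //.
have -> : \det (corner N (val [~ x, y]%g)) =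
    (\det (corner N (val x)) * \det (corner N (val x^-1%g))) *
    (\det (corner N (val y)) * \det (corner N (val y^-1%g))).
  rewrite (corner_mul N0 NxV) ?det_mulmx; last by do !apply: Mp_n_mul => //.
  rewrite (corner_mul N0 NyV) ?det_mulmx; last by do !apply: Mp_n_mul => //.
  by rewrite corner_mul// det_mulmx; ring.
by rewrite !corner_GLpV// mulr1.
Qed.

(** [SL_ind] reduces the claim to products and to commutators of invertible blocks of size [n],
    which lift to elements of [GLp_group F s]. *)
Lemma sl_at_SLp n A : pos_divisors s n -> sl_at n A -> exists g, mat g = A.
Proof.
move=> sn [nA dA]; have n0 := sn.1.
suff H (a : 'M[F]_n) : \det a = 1 -> forall B, is_diag_rep a B -> exists g, mat g = B.
  by apply: (H _ dA); exact: Mp_n_corner.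
have GL (c : 'M[F]_n) : c \in unitmx -> exists x : GLp_group F s, is_diag_rep c (val x).
  move=> cU; have [X cX] := is_diag_rep_exists c n0.
  have [Y cY] := is_diag_rep_exists (invmx c) n0.
  have gX : GLp s X.
    exists n => //; split; first by exists c.
    exists Y; first by exists (invmx c).
    split; apply: (is_diag_rep_inj n0 _ (is_diag_rep1 _ n0)).
      by rewrite -(mulmxV cU); exact: is_diag_rep_mul.
    by rewrite -(mulVmx cU); exact: is_diag_rep_mul.
  by exists (exist _ X (mem_set gX)).
have GLV (x : GLp_group F s) (c : 'M[F]_n) : c \in unitmx ->
    is_diag_rep c (val x) -> is_diag_rep (invmx c) (val x^-1%g).
  move=> cU cx; have cVU : invmx c \in unitmx by rewrite unitmx_inv.
  have [y cy] := GL _ cVU.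
  suff -> : (x^-1)%g = y by [].
  apply: (mulgI x); rewrite mulgV; apply/val_inj.
  apply: (is_diag_rep_inj n0 (is_diag_rep1 _ n0)).
  by rewrite -(mulmxV cU); exact: is_diag_rep_mul.
clear nA dA; move: a; apply: SL_ind => // [B hB|a b ha hb B hB|g h gU hU B hB].
- exists 1%g; exact: is_diag_rep_inj n0 (is_diag_rep1 _ n0) hB.
- have [A1 hA1] := is_diag_rep_exists a n0; have [A2 hA2] := is_diag_rep_exists b n0.
  have [[u eu] [v ev]] := (ha _ hA1, hb _ hA2).
  exists (u * v)%g; rewrite matM eu ev.
  exact: is_diag_rep_inj n0 (is_diag_rep_mul n0 hA1 hA2) hB.
(* Since [[~ x, y]] is the product of [x^-1], [y^-1], [x] and [y], the lifts have to be those of the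
   inverses of [g] and [h]. *)
have gVU : invmx g \in unitmx by rewrite unitmx_inv.
have hVU : invmx h \in unitmx by rewrite unitmx_inv.
have [[x gx] [y hy]] := (GL _ gVU, GL _ hVU).
have [gxV hyV] := (GLV _ _ gVU gx, GLV _ _ hVU hy).
rewrite invmxK in gxV; rewrite invmxK in hyV.
have xyC : [~ x, y]%g \in commutator_subgroup (G := GLp_group F s).
  by apply/mem_set => K [_]; apply; exists x, y.
exists (exist (fun z => z \in commutator_subgroup (G := GLp_group F s)) _ xyC).
apply: (is_diag_rep_inj n0 _ hB); rewrite -!mulmxA.
by do 2?[apply: is_diag_rep_mul => //]; apply: is_diag_rep_mul.
Qed.

End SLp.

(** * Signs, commuting matrices and central involutions *)

Section Signs.
Variable F : fieldType.
Hypothesis char_neq2 : 2%N \notin [pchar F].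

Lemma neq_N1_1 : (-1 == 1 :> F) = false.
Proof.
apply: contraNF (two_neq0 char_neq2) => /eqP e.
by rewrite mulr2n -{1}e addNr.
Qed.

Lemma sign_eq1 k : ((-1) ^+ k == 1 :> F) = ~~ odd k.
Proof.
by rewrite -signr_odd; case: (odd k); rewrite ?expr1 ?neq_N1_1 ?expr0 ?eqxx.
Qed.

Lemma sign_inj : injective (fun b : bool => (-1) ^+ b : F).
Proof.
move=> [] [] //= /eqP; rewrite ?expr1 ?expr0 ?neq_N1_1// eq_sym.
by rewrite neq_N1_1.
Qed.

Lemma sqr1_sign (x : F) : x * x = 1 -> x = (-1) ^+ (x == -1).
Proof.
move=> /eqP; rewrite -expr2 sqrf_eq1; case: (eqVneq x (-1)) => [->//|_].
by rewrite orbF => /eqP.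
Qed.

End Signs.

Section Matrices.
Variable F : fieldType.

(** Commuting with the transvection means commuting with [delta_mx i j]; comparing column [j] of
    both products shows that column [i] of [a] is [a j j] times a unit vector. *)
Lemma commute_transvection n (a : 'M[F]_n) i j :
  a *m transvection i j 1 = transvection i j 1 *m a ->
  a i i = a j j /\ forall k, k != i -> a k i = 0.
Proof.
rewrite /transvection scale1r mulmxDr mulmxDl mulmx1 mul1mx => /addrI e.
have eE k : a k i = (k == i)%:R * a j j.
  have := congr1 (fun b : 'M_n => b k j) e; rewrite !mxE.
  rewrite (bigD1 i)//= big1 => [|l li]; last by rewrite mxE (negPf li) mulr0.
  rewrite mxE !eqxx mulr1 addr0 => ->.
  rewrite (bigD1 j)//= big1 => [|l lj]; last by rewrite mxE (negPf lj) andbF mul0r.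
  by rewrite mxE eqxx andbT addr0.
by split=> [|k /negPf ki]; rewrite eE ?eqxx ?mul1r// ki mul0r.
Qed.

Lemma comm_diag_mxP n (a : 'M[F]_n) d e :
  a *m diag_mx d = diag_mx e *m a <-> forall i j, a i j * d 0 j = e 0 i * a i j.
Proof.
split=> [h i j|h].
  by have := congr1 (fun b : 'M_n => b i j) h; rewrite mul_mx_diag mul_diag_mx !mxE.
by apply/matrixP => i j; rewrite mul_mx_diag mul_diag_mx !mxE.
Qed.

Lemma comm_conj_diag_mxP n (p q y : 'M[F]_n) d : p *m q = 1%:M ->
  y *m (q *m diag_mx d *m p) = q *m diag_mx d *m p *m y <->
  forall i j, (p *m y *m q) i j * d 0 j = d 0 i * (p *m y *m q) i j.
Proof.
move=> pq; have qp := mulmx1C pq.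
rewrite -comm_diag_mxP; split=> [/(congr1 (fun a => p *m a *m q))|/(congr1 (fun a => q *m a *m p))].
  by rewrite !mulmxA pq mul1mx -!mulmxA pq mulmx1 !mulmxA.
by rewrite !mulmxA qp mul1mx -[_ *m q *m p]mulmxA qp mulmx1.
Qed.

Lemma det_neq0_perm n (a : 'M[F]_n) : \det a != 0 ->
  exists s : 'S_n, forall i, a i (s i) != 0.
Proof.
move=> a0; case: (pickP (fun s : 'S_n => \prod_i a i (s i) != 0)) => [s|h].
  by rewrite prodf_seq_neq0 => /allP h; exists s => i; apply: (h i); rewrite mem_index_enum.
case/eqP: a0; apply: big1 => s _.
by have /negbFE/eqP-> := h s; rewrite mulr0.
Qed.

End Matrices.

(** The prescribed factor [m] allows an even level to be requested. *)
Lemma common_level (F : fieldType) (char_neq2 : 2%N \notin [pchar F])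
    (I : finType) s (A : I -> nxn_matrix F) m :
  pos_divisors s m -> (forall i, exists2 n, pos_divisors s n & sl_at n (A i)) ->
  exists N, [/\ pos_divisors s N, (m %| N)%N & forall i, sl_at N (A i)].
Proof.
move=> sm hA.
have hA' i : exists n, pos_divisors s n /\ sl_at n (A i) by have [n] := hA i; exists n.
have [n hn] := boolp.choice hA'.
have sL : pos_divisors s (\big[lcmn/1%N]_i n i).
  elim/big_ind: _ => [|x y|i _]; [exact: pos_divisors1|exact: pos_divisors_lcm|].
  by case: (hn i).
have sN := pos_divisors_lcm sm sL; exists (lcmn m (\big[lcmn/1%N]_i n i)).
split=> //; first exact: dvdn_lcml.
move=> i; have [ni Ai] := hn i.
apply: sl_at_dvd Ai => //; [by case: ni|by case: sN|].
by apply: dvdn_trans (dvdn_lcmr _ _); apply: (biglcmn_sup i).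
Qed.

Section Center.
Variables (F : fieldType) (s : steinitz).
Hypothesis char_neq2 : 2%N \notin [pchar F].

(** Commuting with all transvections makes [z] scalar at its level [N]. A scalar involution other
    than 1 is -1, and its determinant [(-1) ^+ N] is 1 only for even [N]. *)
Lemma central_involution (z : SLp_group F s) :
  (forall g, g * z = z * g)%g -> (z * z = 1)%g -> z <> 1%g -> pos_divisors s 2.
Proof.
move=> zC zz z1; have [N sN [NA dA]] := SLp_sl_at char_neq2 z; have N0 := sN.1.
set a := corner N (mat z) in dA.
have aT i j : i != j -> a i i = a j j /\ forall k, k != i -> a k i = 0.
  move=> ij; apply: commute_transvection.
  have [T NT eT] := @sl_at_rep F N (transvection i j 1) N0 (det_transvection _ ij).
  have [g gT] := sl_at_SLp char_neq2 sN NT.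
  rewrite -eT -!corner_mul//; try by case: NT.
  by rewrite -gT -!matM zC.
have a_scalar : a = (a (Ordinal N0) (Ordinal N0))%:M.
  apply/matrixP => i j; rewrite [RHS]mxE; case: (eqVneq i j) => [<-|ij]; last first.
    by have /aT[_ ->] : j != i by rewrite eq_sym.
  case: (eqVneq i (Ordinal N0)) => [->//|/aT[-> _]]; by rewrite mulr1n.
set x := a _ _ in a_scalar.
have := congr1 (fun g => corner N (mat g)) zz; rewrite matM corner_mul// mat1 corner_one//.
rewrite -/a a_scalar -scalar_mxM => /(congr1 (fun b : 'M_N => b (Ordinal N0) (Ordinal N0))).
rewrite !mxE eqxx !mulr1n => /sqr1_sign.
case: eqP => [_ /= xN1|_ /= x1].
  apply: pos_divisors_dvd sN; rewrite dvdn2 -(sign_eq1 char_neq2).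
  by move: dA; rewrite a_scalar det_scalar xN1 expr1 => ->.
case: z1; apply: mat_inj; apply: (corner_inj N0) => //.
  by exists 1%:M; exact: is_diag_rep1.
by rewrite mat1 corner_one// -/a a_scalar x1 expr0.
Qed.

End Center.

Lemma involution_diagonalizable (F : fieldType) n (a : 'M[F]_n) :
  2%N \notin [pchar F] -> (0 < n)%N -> a *m a = 1%:M -> diagonalizable a.
Proof.
case: n a => // n a char_neq2 _ aa; apply/diagonalizableP; exists [:: 1; -1].
  by rewrite /= inE eq_sym neq_N1_1.
apply: mxminpoly_min; rewrite !big_cons big_nil mulr1 rmorphM !rmorphB /= !horner_mx_X.
rewrite !horner_mx_C rmorphN/= opprK mulrDr mulr1 mulrBl mul1r.
by rewrite [a * a]aa addrA subrK subrr.
Qed.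

Lemma corner_diag (F : fieldType) n (d : nat -> F) :
  corner n (nxn_diag d) = diag_mx (\row_(i < n) d i).
Proof. by apply/matrixP => i j; rewrite !mxE mulrb. Qed.

(** * Groups of sign patterns inside [SLp_group] *)

Section ShiftSystem.
Variables (F : fieldType) (s : steinitz) (n m : nat).
Hypothesis char_neq2 : 2%N \notin [pchar F].
Local Notation K := {ffun 'I_n -> bool}.
Local Notation E := (even_patterns (fun _ : 'I_n => m)).
Variables (b : K -> SLp_group F s) (c : SLp_group F s).
Hypothesis n3 : (2 < n)%N.
Hypothesis n_odd : odd n -> odd m.
Hypothesis n_even : ~~ odd n -> pos_divisors s 2.
Hypothesis bb : forall w, (b w * b w = 1)%g.
Hypothesis b_comm : forall v w, (b v * b w = b w * b v)%g.
Hypothesis cb : forall w, (c * b w = b (shift w) * c)%g.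
Hypothesis b_inj : {in E &, injective b}.
Hypothesis b_closed : forall z : SLp_group F s, (z * z = 1)%g ->
  (forall y, (forall w, y * b w = b w * y)%g -> y * z = z * y)%g ->
  exists2 w, w \in E & z = b w.

Lemma shift_system_dvd : pos_divisors s n.
Proof.
(* For even [n] the counting lemma needs the eigenspace dimensions to have an even sum, so the level
   [N] is made even. *)
have se : pos_divisors s (if odd n then 1%N else 2%N).
  by case: ifPn => // _; exact: pos_divisors1.
pose A (o : option K) := mat (if o is Some w then b w else c).
have [|N [sN eN hA]] := @common_level _ char_neq2 _ s A _ se.
  by move=> o; exact: SLp_sl_at.
have N0 := sN.1.
pose R w := corner N (mat (b w)); pose C := corner N (mat c).
have bN w : Mp_n N (mat (b w)) by case: (hA (Some w)).
have detR w : \det (R w) = 1 by case: (hA (Some w)).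
have [cN detC] : Mp_n N (mat c) /\ \det C = 1 by exact: (hA None).
have RR w : R w *m R w = 1%:M by rewrite -corner_mul// -matM bb mat1 corner_one.
have R_comm v w : R v *m R w = R w *m R v by rewrite -!corner_mul// -!matM b_comm.
have CR w : C *m R w = R (shift w) *m C by rewrite -!corner_mul// -!matM cb.
have [P PU hP] : exists2 P : 'M[F]_N, P \in unitmx &
    forall w, exists d, P *m R w = diag_mx d *m P.
  have : codiagonalizable [seq R w | w : K].
    apply/codiagonalizableP; split.
      by move=> _ _ /codomP[v ->] /codomP[w ->]; exact: R_comm.
    by move=> _ /codomP[w ->]; exact: involution_diagonalizable.
  case=> P PU /allP hP; exists P => // w.
  have /diagonalizable_forPex[d] := hP _ (codom_f R w).
  by move=> /(simmxP PU); exists d.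
have [d hd] := boolp.choice hP.
have hd' w : invmx P *m diag_mx (d w) = R w *m invmx P.
  by apply: (can_inj (mulmxK PU)); rewrite mulmxKV// -mulmxA -hd mulKmx.
have dd w i : d w 0 i * d w 0 i = 1.
  have : diag_mx (d w) *m diag_mx (d w) = 1%:M.
    apply: (can_inj (mulmxK PU)); rewrite mul1mx -mulmxA -hd mulmxA -hd -mulmxA RR.
    by rewrite mulmx1.
  move/(congr1 (fun a : 'M_N => a i i)); rewrite mulmx_diag !mxE eqxx.
  by rewrite !mulr1n.
pose eps i : {ffun K -> bool} := [ffun w => d w 0 i == -1].
have dE w i : d w 0 i = (-1) ^+ eps i w by rewrite ffunE; exact: sqr1_sign.
(* A nonzero term of the Leibniz expansion of [det C'] matches eigenvectors of
   the character [eps i] with eigenvectors of its shift. *)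
have [p hp] : exists p : 'S_N, forall i w, eps (p i) w = eps i (shift w).
  pose C' := P *m C *m invmx P.
  have C'0 : \det C' != 0.
    by rewrite !det_mulmx detC mulr1 det_inv divff ?oner_neq0// -unitfE -unitmxE.
  have [p hp] := det_neq0_perm C'0; exists p => i w.
  apply: (@sign_inj _ char_neq2); rewrite /= -!dE.
  have : C' *m diag_mx (d w) = diag_mx (d (shift w)) *m C'.
    by rewrite /C' -mulmxA hd' !mulmxA -(mulmxA P) CR mulmxA hd.
  by move/comm_diag_mxP/(_ i (p i)); rewrite mulrC => /mulIf; exact.
have shiftK : cancel (pull (@ordS n)) (pull (@ord_pred n)).
  by move=> w; apply/ffunP => i; rewrite !ffunE ord_predK.
have shiftK' : cancel (pull (@ord_pred n)) (pull (@ordS n)).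
  by move=> w; apply/ffunP => i; rewrite !ffunE ordSK.
(* The distinct joint eigencharacters of the [b w]; [g i] is the one carried by the [i]-th
   eigenvector. *)
pose T := {x : {ffun K -> bool} | x \in codom eps}.
pose g i : T := Sub (eps i) (codom_f eps i).
have gP (x : T) : exists i, x = g i.
  by case: x => x hx; case/codomP: (hx) => i ei; exists i; apply/val_inj.
have shiftT (x : T) : [ffun w => val x (shift w)] \in codom eps.
  have [i ->] := gP x; apply/codomP; exists (p i).
  by apply/ffunP => w; rewrite [LHS]ffunE [RHS]hp.
pose tf (x : T) : T := Sub [ffun w => val x (shift w)] (shiftT x).
have tfE x w : val (tf x) w = val x (shift w) by rewrite /= ffunE.
have tf_inj : injective tf.
  move=> x y exy; apply/val_inj/ffunP => w.
  by rewrite -(shiftK' w) -!tfE exy.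
pose t := perm tf_inj.
have gp i : g (p i) = t (g i).
  by rewrite permE; apply/val_inj/ffunP => w; rewrite tfE [LHS]hp.
pose dim (x : T) := (\sum_i (g i == x))%N.
have dim_t x : dim (t x) = dim x.
  rewrite /dim (reindex_inj (@perm_inj _ p)); apply: eq_bigr => i _.
  by rewrite gp (inj_eq perm_inj).
have sum_dim (f : {ffun T -> bool}) : (\sum_i f (g i) = \sum_x f x * dim x)%N.
  rewrite /dim; under [RHS]eq_bigr do rewrite big_distrr.
  rewrite exchange_big; apply: eq_bigr => i _ /=.
  rewrite (bigD1 (g i))//= eqxx muln1 big1 ?addn0// => x /negPf.
  by rewrite eq_sym => ->; rewrite muln0.
pose h (w : K) : {ffun T -> bool} := [ffun x : T => val x w].
have hgE w i : h w (g i) = eps i w by rewrite ffunE.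
have bE v w : (forall i, eps i v = eps i w) -> b v = b w.
  move=> e; apply: mat_inj; apply: (corner_inj N0) => //.
  rewrite -/(R v) -/(R w); apply: (can_inj (mulKmx PU)); rewrite !hd.
  by congr (diag_mx _ *m _); apply/rowP => i; rewrite !dE e.
have det_sign (f : {ffun T -> bool}) :
    \det (diag_mx (\row_i ((-1) ^+ f (g i)) : 'rV[F]_N)) = (-1) ^+ (\sum_x f x * dim x).
  rewrite det_diag -sum_dim -prodrXr; apply: eq_bigr => i _.
  by rewrite mxE.
have sum_dimN : (\sum_x dim x = N)%N.
  transitivity (\sum_x ([ffun=> true] : {ffun T -> bool}) x * dim x)%N.
    by apply: eq_bigr => x _; rewrite ffunE mul1n.
  rewrite -sum_dim; under eq_bigr do rewrite ffunE.
  by rewrite sum_nat_const card_ord muln1.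
suff nN : (n %| \sum_x dim x)%N by apply: pos_divisors_dvd sN; rewrite -sum_dimN.
apply: (@dvdn_sum_weights n m T dim t h) => //.
- by move=> ne; rewrite sum_dimN -dvdn2; move: eN; rewrite (negPf ne).
- move=> v w vE wE hvw; apply: b_inj => //; apply: bE => i.
  by rewrite -!hgE hvw.
- apply/setP => f; apply/imsetP/idP => [[w wE ->]|fE].
    rewrite inE -(sign_eq1 char_neq2) -det_sign.
    have -> : \row_i (-1) ^+ h w (g i) = d w.
      by apply/rowP => i; rewrite mxE hgE dE.
    apply/eqP/(mulIf (x := \det P)); first by rewrite -unitfE -unitmxE.
    by rewrite -det_mulmx -hd det_mulmx detR mulr1 mul1r.
  (* Surjectivity: the matrix acting by the sign [f x] on the eigenspace of each [x] has determinant
     1, so it comes from an involution [z]; [b_closed] will show that [z] is some [b w]. *)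
  pose e : 'rV[F]_N := \row_i (-1) ^+ f (g i).
  have dete : \det (diag_mx e) = 1.
    by rewrite det_sign; apply/eqP; rewrite (sign_eq1 char_neq2); move: fE; rewrite inE.
  have det_zm : \det (invmx P *m diag_mx e *m P) = 1.
    by rewrite !det_mulmx mulrAC -det_mulmx mulVmx// det1 mul1r dete.
  have [Z NZ eZ] := sl_at_rep N0 det_zm; have [z zZ] := sl_at_SLp char_neq2 sN NZ.
  have Nz : Mp_n N (mat z) by rewrite zZ; case: NZ.
  have zz : (z * z = 1)%g.
    apply: mat_inj; apply: (corner_inj N0); rewrite ?matM ?mat1.
    - exact: Mp_n_mul.
    - by exists 1%:M; exact: is_diag_rep1.
    rewrite corner_mul// corner_one// zZ eZ -!mulmxA (mulKVmx PU) (mulmxA (diag_mx e)).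
    rewrite (_ : diag_mx e *m diag_mx e = 1%:M) ?mul1mx ?mulVmx//.
    by rewrite mulmx_diag; apply/matrixP => i j; rewrite !mxE -expr2 sqrr_sign.
  have [|w wE zw] := b_closed zz.
    (* The element [y] may live at another level, so the comparison takes place at a common multiple
       [M], where the eigenvalues repeat with period [N]. *)
    move=> y yb; have [l sl [ly _]] := SLp_sl_at char_neq2 y.
    have sM := pos_divisors_lcm sN sl; move: (dvdn_lcml N l) (dvdn_lcmr N l).
    move: (lcmn N l) sM => M sM NM lM; have M0 := sM.1.
    have up B : Mp_n N B -> Mp_n M B by exact: Mp_n_dvd.
    have My : Mp_n M (mat y) by apply: Mp_n_dvd ly.
    have [PP hPP] := is_diag_rep_exists P N0.
    have [QQ hQQ] := is_diag_rep_exists (invmx P) N0.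
    have [MP MQ] : Mp_n M PP /\ Mp_n M QQ.
      by split; apply: up; [exists P|exists (invmx P)].
    pose om (i : nat) : 'I_N := Ordinal (ltn_pmod i N0).
    pose D (u : 'rV[F]_N) := nxn_diag (fun i => u 0 (om i)).
    have omE i : om i = om (i %% N)%N by apply/val_inj; rewrite /= modn_mod.
    have D_rep u : is_diag_rep (diag_mx u) (D u).
      have := @nxn_diag_rep F N (fun i => u 0 (om i)) N0 (fun i => congr1 (u 0) (omE i)).
      congr (is_diag_rep (diag_mx _) _); apply/rowP => i; rewrite mxE.
      by congr (u 0 _); apply/val_inj; rewrite /= modn_small.
    have DM u : Mp_n M (D u) by apply: up; exists (diag_mx u).
    have conj_rep u (x : SLp_group F s) : Mp_n N (mat x) ->
        corner N (mat x) = invmx P *m diag_mx u *m P ->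
        corner M (mat x) = corner M QQ *m corner M (D u) *m corner M PP.
      move=> Nx ex; rewrite -corner_mul// -corner_mul//; last exact: Mp_n_mul.
      congr corner; apply: (is_diag_rep_inj N0 (Mp_n_corner Nx)); rewrite ex.
      by do 2?apply: is_diag_rep_mul.
    have PQ : corner M PP *m corner M QQ = 1%:M.
      rewrite -corner_mul// -(corner_one F M0); congr corner.
      apply: (is_diag_rep_inj N0 (is_diag_rep_mul N0 hPP hQQ)).
      by rewrite mulmxV//; exact: is_diag_rep1.
    have QP := mulmx1C PQ.
    pose y' := corner M PP *m corner M (mat y) *m corner M QQ.
    have key u (x : SLp_group F s) : Mp_n N (mat x) ->
        corner N (mat x) = invmx P *m diag_mx u *m P ->
      (y * x = x * y)%g <-> (forall i j : 'I_M, y' i j * u 0 (om j) = u 0 (om i) * y' i j).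
      move=> Nx ex; have ec := conj_rep u x Nx ex.
      have -> : (y * x = x * y)%g <->
          corner M (mat y) *m corner M (mat x) = corner M (mat x) *m corner M (mat y).
        rewrite -!corner_mul//; try exact: up.
        split=> [xy|xy]; first by rewrite -!matM xy.
        apply: mat_inj; apply: (corner_inj M0) => //; apply: Mp_n_mul => //; exact: up.
      rewrite ec corner_diag comm_conj_diag_mxP//.
      by split=> e1 i j; move: (e1 i j); rewrite !mxE.
    have R_conj w : corner N (mat (b w)) = invmx P *m diag_mx (d w) *m P.
      by rewrite -mulmxA -hd mulKmx.
    apply/(key e z Nz); first by rewrite zZ.
    (* In the eigenbasis, a nonzero entry of [y'] joins two vectors on which every [b w] has the
       same eigenvalue. They share their character, so [f] gives them the same sign. *)
    move=> i j; have [->|nz] := eqVneq (y' i j) 0.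
      by rewrite mul0r mulr0.
    rewrite mulrC; congr (_ * _); rewrite !mxE; congr (_ ^+ _); congr (nat_of_bool (f _)).
    apply/val_inj/ffunP => w; apply: (@sign_inj _ char_neq2); rewrite /= -!dE.
    have /(key (d w) (b w) (bN w) (R_conj w))/(_ i j) := yb w.
    by rewrite mulrC => /mulIf; exact.
  exists w => //; apply/ffunP => x; have [i ->] := gP x; rewrite hgE.
  apply: (@sign_inj _ char_neq2); rewrite /= -dE.
  suff -> : d w = e by rewrite mxE.
  have : diag_mx (d w) = diag_mx e.
    apply: (can_inj (mulmxK PU)); rewrite -hd /R -zw zZ eZ -mulmxA mulKVmx//.
  move=> /matrixP ed; apply/rowP => j; have := ed j j; by rewrite !mxE eqxx !mulr1n.
- by move=> w _; apply/ffunP => x; rewrite !ffunE permE tfE.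
Qed.

End ShiftSystem.

(** * Construction of the periodic sign matrices and their cyclic shift *)

Lemma sum_modn n q (g : nat -> nat) :
  (\sum_(i < n * q) g (i %% n) = (\sum_(i < n) g i) * q)%N.
Proof.
elim: q => [|q IHq]; first by rewrite muln0 big_ord0 muln0.
rewrite mulnS big_split_ord /= mulnS -IHq; congr (_ + _)%N.
  by apply: eq_bigr => i _; rewrite modn_small.
by apply: eq_bigr => i _; rewrite modnDl.
Qed.

Section ShiftSystemExists.
Variables (F : fieldType) (s : steinitz) (n m : nat).
Hypothesis char_neq2 : 2%N \notin [pchar F].
Hypothesis n3 : (2 < n)%N.
Hypothesis snm : pos_divisors s (n * m)%N.
(* [m] only matters through its parity: it is odd when [n] has the same 2-part
   as [s], and even when [2 * n] divides [s]. *)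
Hypothesis m_odd : odd m -> forall q, pos_divisors s (n * q)%N -> odd q.
Local Notation K := {ffun 'I_n -> bool}.
Local Notation E := (even_patterns (fun _ : 'I_n => m)).

Let n0 : (0 < n)%N. Proof. exact: leq_trans n3. Qed.
Let sn : pos_divisors s n.
Proof. exact: pos_divisors_dvd (dvdn_mulr _ _) snm. Qed.
Let om (i : nat) : 'I_n := Ordinal (ltn_pmod i n0).

Definition sign_pattern (w : K) : nxn_matrix F := nxn_diag (fun i => (-1) ^+ w (om i)).

Let om_mod N i : (n %| N)%N -> om (i %% N) = om i.
Proof. by move=> nN; apply/val_inj; rewrite /= modn_dvdm. Qed.

Let pat_Mp N w : (0 < N)%N -> (n %| N)%N -> Mp_n N (sign_pattern w).
Proof.
move=> N0 nN; eexists; apply: nxn_diag_rep => // i.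
by rewrite om_mod.
Qed.

Let pat_det q w : \det (corner (n * q)%N (sign_pattern w)) = (-1) ^+ (\sum_i w i * q).
Proof.
rewrite corner_diag det_diag -big_distrl /=.
have <- : (\sum_(i < n * q) w (om i) = (\sum_i w i) * q)%N.
  rewrite -[RHS](_ : (\sum_(i < n) w (om i)) * q = _)%N; last first.
    congr (_ * _)%N; apply: eq_bigr => i _; congr (nat_of_bool (w _)).
    by apply/val_inj; rewrite /= modn_small.
  rewrite -(sum_modn n q (fun i => w (om i))).
  by apply: eq_bigr => i _; rewrite om_mod.
by rewrite -prodrXr; apply: eq_bigr => i _; rewrite mxE.
Qed.

Let pat_exists w : w \in E -> exists g : SLp_group F s, mat g = sign_pattern w.
Proof.
move=> wE; apply: (sl_at_SLp char_neq2 snm); split.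
  by apply: pat_Mp; [case: snm|exact: dvdn_mulr].
by rewrite pat_det; apply/eqP; rewrite sign_eq1//; move: wE; rewrite inE.
Qed.

(** For even [m] every pattern is in [E]. For odd [m], a level [n * q] of [g] has odd [q] by
    [m_odd], so determinant 1 forces an even number of minus signs. *)
Let pat_even w (g : SLp_group F s) : mat g = sign_pattern w -> w \in E.
Proof.
move=> gw; rewrite inE; case/boolP: (odd m) => [mo|me]; last first.
  by rewrite -big_distrl oddM (negPf me) andbF.
have [k sk gk] := SLp_sl_at char_neq2 g.
have sN := pos_divisors_lcm sn sk; move: (dvdn_lcml n k) (dvdn_lcmr n k) sN.
move: (lcmn n k) => N /dvdnP[q ->] kN; rewrite mulnC in kN *; move=> sN.
have [_] := sl_at_dvd char_neq2 sk.1 sN.1 kN gk.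
rewrite gw pat_det => /eqP; rewrite sign_eq1// -!big_distrl !oddM mo.
by rewrite (m_odd mo sN).
Qed.

(* Patterns outside [E] are sent to the identity, so that the relations of the
   shift system hold for all [w]. *)
Let clip (w : K) : K := if w \in E then w else [ffun=> false].

Let zeroE : [ffun=> false] \in E.
Proof. by rewrite inE big1// => i _; rewrite ffunE. Qed.

Let clipE w : clip w \in E.
Proof. by rewrite /clip; case: ifP. Qed.

Let clip_shift w : clip (shift w) = shift (clip w).
Proof.
rewrite /clip pull_even_patterns//; last exact: ordS_inj.
by case: ifP => // _; apply/ffunP => i; rewrite !ffunE.
Qed.

Let commute_at N (x y : SLp_group F s) : (0 < N)%N -> Mp_n N (mat x) -> Mp_n N (mat y) ->
  corner N (mat x) *m corner N (mat y) = corner N (mat y) *m corner N (mat x) <->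
  (x * y = y * x)%g.
Proof.
move=> N0 Nx Ny; rewrite -!corner_mul// -!matM; split=> [xy|->//].
by apply: mat_inj; apply: (corner_inj N0) xy; rewrite matM; exact: Mp_n_mul.
Qed.

Lemma shift_system_exists : exists (b : K -> SLp_group F s) (c : SLp_group F s),
  [/\ forall w, (b w * b w = 1)%g, forall v w, (b v * b w = b w * b v)%g,
      forall w, (c * b w = b (shift w) * c)%g, {in E &, injective b} &
      forall z : SLp_group F s, (z * z = 1)%g ->
        (forall y, (forall w, y * b w = b w * y)%g -> y * z = z * y)%g ->
        exists2 w, w \in E & z = b w].
Proof.
have [b hb] := boolp.choice (fun w => pat_exists (clipE w)).
have bN N w : (0 < N)%N -> (n %| N)%N -> Mp_n N (mat (b w)).
  by rewrite hb; exact: pat_Mp.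
have b_comm v w : (b v * b w = b w * b v)%g.
  apply/(commute_at n0); rewrite ?hb ?corner_diag; try exact: pat_Mp.
  apply/comm_diag_mxP => i j; rewrite !mxE; case: (eqVneq i j) => [->|_]; first by rewrite mulrC.
  by rewrite !mulr0n mul0r mulr0.
have [c nc hc] : exists2 c : SLp_group F s, Mp_n n (mat c) &
    forall i j, j != ordS i -> corner n (mat c) i j = 0.
  pose o : 'I_n := Ordinal n0; pose p := perm (@ordS_inj n).
  (* A cyclic permutation matrix with one entry rescaled by the sign of the permutation, so that the
     determinant becomes 1. *)
  pose a : 'M[F]_n := diag_mx (\row_i if i == o then (-1) ^+ p else 1) *m perm_mx p.
  have a1 : \det a = 1.
    rewrite det_mulmx det_diag det_perm (bigD1 o)//= big1 => [|i /negPf io].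
      by rewrite mxE eqxx mulr1 -expr2 sqrr_sign.
    by rewrite mxE io.
  have [A NA eA] := sl_at_rep n0 a1; have [c cA] := sl_at_SLp char_neq2 sn NA.
  exists c; rewrite cA; first by case: NA.
  rewrite eA => i j ji; rewrite /a mul_diag_mx !mxE permE.
  by rewrite [_ == j]eq_sym (negPf ji) mulr0.
exists b, c; split=> //.
- move=> w; apply: mat_inj; apply: (corner_inj n0); rewrite ?matM ?mat1.
  + by apply: Mp_n_mul => //; exact: bN.
  + by exists 1%:M; exact: is_diag_rep1.
  rewrite corner_mul//; try exact: bN.
  rewrite corner_one// hb corner_diag mulmx_diag; apply/matrixP => i j.
  by rewrite !mxE -expr2 sqrr_sign.
- move=> w; apply: mat_inj; apply: (corner_inj n0); rewrite !matM;
    do ?[apply: Mp_n_mul => //; try exact: bN].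
  rewrite !corner_mul//; try exact: bN.
  rewrite !hb !corner_diag clip_shift; apply/comm_diag_mxP => i j.
  have [->|/hc->] := eqVneq j (ordS i); last by rewrite mul0r mulr0.
  rewrite mulrC; congr (_ * _); rewrite !mxE ffunE; congr (_ ^+ _); congr (nat_of_bool (clip w _)).
  apply/val_inj; rewrite /= modn_mod; congr ((_.+1) %% _)%N.
  by rewrite modn_small.
- move=> v w vE wE vw; have : sign_pattern v = sign_pattern w.
    by have := congr1 (@mat _ _) vw; rewrite !hb /clip vE wE.
  move=> e; apply/ffunP => i; have := congr1 (fun A : nxn_matrix F => A i i) e.
  rewrite /sign_pattern /nxn_diag eqxx => /(@sign_inj _ char_neq2).
  by have -> : om i = i by apply/val_inj; rewrite /= modn_small.
move=> z zz zC.
have [k sk gk] := SLp_sl_at char_neq2 z.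
have sN := pos_divisors_lcm sn sk; move: (dvdn_lcml n k) (dvdn_lcmr n k) sN.
move: (lcmn n k) => N nN kN sN; have N0 := sN.1.
have [Nz _] := sl_at_dvd char_neq2 sk.1 N0 kN gk.
set a := corner N (mat z).
have zb w : (b w * z = z * b w)%g by apply: zC => v; exact: b_comm.
have a_om (i j : 'I_N) : om i != om j -> a i j = 0.
  (* A third residue [r], available since [2 < n], gives an even pattern that negates [om i] and
     fixes [om j]; commuting with it kills the entry. *)
  move=> ij; have [r /andP[ri rj]] : exists r : 'I_n, (r != om i) && (r != om j).
    have : (0 < #|~: [set om i; om j]|)%N.
      by rewrite cardsCs finset.setCK card_ord cards2 ij subn_gt0.
    by case/card_gt0P => r; rewrite !inE negb_or => rij; exists r.
  pose w : K := [ffun l => (l == om i) || (l == r)].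
  have wE : w \in E.
    rewrite inE (bigD1 (om i))//= (bigD1 r)/= ?ri// big1 => [|l /andP[li lr]].
      by rewrite !ffunE !eqxx orbT !mul1n addn0 addnn odd_double.
    by rewrite ffunE (negPf li) (negPf lr).
  have /(commute_at N0 (bN _ _ N0 nN) Nz) := zb w.
  rewrite hb /clip wE corner_diag => /esym/comm_diag_mxP/(_ i j)/eqP.
  rewrite !mxE !ffunE eqxx [om j == _]eq_sym (negPf ij) [om j == _]eq_sym (negPf rj).
  rewrite expr0 expr1 mulr1 mulN1r -/(corner N (mat z)) -addr_eq0 -mulr2n -mulr_natl mulf_eq0.
  by rewrite (negPf (two_neq0 char_neq2)) => /eqP.
have a_tr (i j : 'I_N) : i != j -> om i = om j -> a i i = a j j /\ a j i = 0.
  (* A transvection between coordinates of equal residue commutes with every [b w], so it also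
     commutes with [z]. This makes [z] scalar on each residue class. *)
  move=> ij oij; have [T NT eT] := sl_at_rep N0 (det_transvection (1 : F) ij).
  have [y yT] := sl_at_SLp char_neq2 sN NT.
  have Ny : Mp_n N (mat y) by rewrite yT; case: NT.
  have := zC y; rewrite -(commute_at N0 Ny Nz) yT eT => H.
  have [|e1 e2] := @commute_transvection F N a i j; last by split=> //; apply: e2; rewrite eq_sym.
  rewrite H// => w; apply/(commute_at N0 Ny (bN _ _ N0 nN)); rewrite yT eT hb corner_diag.
  apply/comm_diag_mxP => u v; rewrite mulrC !mxE mul1r.
  have [->//|uv] := eqVneq u v; rewrite add0r.
  by case: andP => [[/eqP-> /eqP->]|_]; rewrite ?oij// !mulr0.
have a_diag (i j : 'I_N) : i != j -> a i j = 0.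
  move=> ij; case: (eqVneq (om i) (om j)) => [eij|]; last exact: a_om.
  by have [] := @a_tr j i; rewrite 1?eq_sym.
have leN (i : 'I_n) : (i < N)%N := leq_trans (ltn_ord i) (dvdn_leq N0 nN).
pose w : K := [ffun i => a (Ordinal (leN i)) (Ordinal (leN i)) == -1].
have aE (i : 'I_N) : a i i = (-1) ^+ w (om i).
  rewrite ffunE; set i' := Ordinal _.
  have -> : a i i = a i' i'.
    have [<-//|ii'] := eqVneq i i'; have [|-> //] := a_tr i i' ii'.
    by apply/val_inj; rewrite /= modn_mod.
  apply: sqr1_sign; have := congr1 (fun g => corner N (mat g) i' i') zz.
  rewrite matM corner_mul// mat1 corner_one// [RHS]mxE eqxx => zz1; rewrite -[RHS]zz1.
  rewrite [RHS]mxE (bigD1 i')//= big1 ?addr0// => l li.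
  by rewrite -/a (a_diag l i') ?mulr0.
have zw : mat z = sign_pattern w.
  apply: (corner_inj N0) => //; first exact: pat_Mp.
  rewrite corner_diag; apply/matrixP => i j; rewrite -/a 2![in RHS]mxE.
  by have [<-|/a_diag->] := eqVneq i j; rewrite ?mulr0n// -aE.
have wE := pat_even zw; exists w => //; apply: mat_inj.
by rewrite hb /clip wE.
Qed.

End ShiftSystemExists.

(** * Transfer of divisors along an isomorphism *)

Section Transfer.
Variables (F : fieldType) (s1 s2 : steinitz).
Hypothesis char_neq2 : 2%N \notin [pchar F].
Variables (f : {multiplicative SLp_group F s1 -> SLp_group F s2}).
Hypothesis f_bij : bijective f.

Let f1 : f 1%g = 1%g.
Proof. by apply: (mulgI (f 1%g)); rewrite -gmulfM !mulg1. Qed.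

Lemma two_transfer : pos_divisors s1 2 -> pos_divisors s2 2.
Proof.
move=> s12; pose A : nxn_matrix F := nxn_diag (fun=> -1).
have A_Mp N : (0 < N)%N -> Mp_n N A by move=> N0; eexists; exact: nxn_diag_rep.
have A2 : sl_at 2 A.
  split; first exact: A_Mp.
  by rewrite corner_diag det_diag !big_ord_recl big_ord0 !mxE mulr1 mulrNN mulr1.
have [z zA] := sl_at_SLp char_neq2 s12 A2.
have zz : (z * z = 1)%g.
  apply: mat_inj; apply: (@corner_inj F 1) => //; rewrite ?matM ?mat1 ?zA.
  - by apply: Mp_n_mul => //; exact: A_Mp.
  - by exists 1%:M; exact: is_diag_rep1.
  rewrite corner_mul ?corner_one//; try exact: A_Mp.
  by rewrite /A corner_diag mulmx_diag; apply/matrixP => i j; rewrite !mxE mulrNN mulr1.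
have z1 : z <> 1%g.
  move=> /(congr1 (fun g => mat g 0%N 0%N)); rewrite zA mat1 /A /nxn_diag /nxn_one eqxx.
  by move/eqP; rewrite neq_N1_1.
have zC g : (g * z = z * g)%g.
  apply: mat_inj; rewrite !matM zA; have [N sN [Ng _]] := SLp_sl_at char_neq2 g.
  have [N0 AN] := (sN.1, A_Mp N sN.1); apply: (corner_inj N0); try exact: Mp_n_mul.
  rewrite !corner_mul// /A corner_diag; apply/comm_diag_mxP => i j.
  by rewrite !mxE mulrC.
apply: (central_involution char_neq2 (z := f z)) => [g||fz].
- by have [f' fK f'K] := f_bij; rewrite -[g]f'K -!gmulfM zC.
- by rewrite -gmulfM zz f1.
by apply: z1; apply: (bij_inj f_bij); rewrite fz f1.
Qed.

(** The shift system of the first group is carried over by [f]; its closure property transfers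
    because it only involves involutions and centralizers. *)
Lemma pos_divisors_transfer n m : pos_divisors s1 (n * m)%N ->
  (odd m -> forall q, pos_divisors s1 (n * q)%N -> odd q) ->
  (odd n -> odd m) -> pos_divisors s2 n.
Proof.
move=> snm m_odd n_odd; have sn := pos_divisors_dvd (dvdn_mulr _ (dvdnn n)) snm.
have n_even : ~~ odd n -> pos_divisors s2 2.
  by rewrite -dvdn2 => n2; apply/two_transfer/(pos_divisors_dvd n2 sn).
(* The count requires [2 < n]; the cases 1 and 2 are immediate. *)
have [n3|] := ltnP 2 n; last first.
  case: n sn n_even {snm m_odd n_odd} => [[]//|[_ _ _|[_ /(_ isT)//|//]]].
  exact: pos_divisors1.
have [b [c [bb b_comm cb b_inj b_closed]]] := shift_system_exists char_neq2 n3 snm m_odd.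
have [f' fK f'K] := f_bij.
apply: (@shift_system_dvd F s2 n m char_neq2 (f \o b) (f c)) => //=.
- by move=> w; rewrite -gmulfM bb f1.
- by move=> v w; rewrite -!gmulfM b_comm.
- by move=> w; rewrite -!gmulfM cb.
- by move=> v w vE wE /(can_inj fK); exact: b_inj.
move=> z zz zC; have [||w wE zw] := b_closed (f' z).
- by apply: (can_inj fK); rewrite gmulfM f'K zz f1.
- move=> y yb; apply: (can_inj fK); rewrite !gmulfM f'K; apply: zC => w.
  by rewrite -!gmulfM yb.
by exists w => //; rewrite -zw f'K.
Qed.

Lemma pos_divisors_iso k : pos_divisors s1 k -> pos_divisors s2 k.
Proof.
move=> sk; have k0 := sk.1; pose two : {p : nat | prime p} := exist _ 2%N isT.
have [_ hk] := (pos_divisorsP _ _).1 sk.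
case e: (s1 two) => [r|].
  have kr : (logn 2 k <= r)%N by exact: (hk two).
  (* Now [n] has the full 2-part of [s1], so any cofactor [q] is odd and [m = 1] is admissible. *)
  pose n := (k * 2 ^ (r - logn 2 k))%N.
  have log2n : logn 2 n = r by rewrite lognM ?expn_gt0// pfactorK// subnKC.
  have sn : pos_divisors s1 n.
    apply/pos_divisorsP; split; first by rewrite muln_gt0 k0 expn_gt0.
    move=> p t pt; have [p2|p2] := eqVneq (val p) 2.
      have ep : p = two by exact/val_inj.
      by rewrite p2 log2n; move: pt; rewrite ep e => -[->].
    rewrite lognM ?expn_gt0// lognX (_ : logn (val p) 2 = 0)%N ?muln0 ?addn0; first exact: hk.
    by rewrite logn_prime// (negPf p2).
  apply: (@pos_divisors_dvd _ _ n); first exact: dvdn_mulr.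
  apply: (@pos_divisors_transfer n 1); rewrite ?muln1// => _ q sq.
  have [q0 /(_ two _ e)/=] := (pos_divisorsP _ _).1 sq.
  move: q0; rewrite muln_gt0 => /andP[n0 q0]; rewrite lognM// log2n -[leqRHS]addn0 leq_add2l leqn0.
  by rewrite -[odd q]negbK -dvdn2; apply: contraTN => q2; rewrite -lt0n logn_gt0 mem_primes q0.
(* Infinite 2-part: the even number [k * 2] is used with [m = 2], which makes both parity conditions
   on [m] vacuous. *)
have s4 : pos_divisors s1 (k * 2 * 2)%N.
  apply/pos_divisorsP; split; first by rewrite !muln_gt0 k0.
  move=> p t pt; have p2 : val p != 2.
    by apply: contra_eqN pt => /eqP p2; rewrite (_ : p = two) ?e//; exact/val_inj.
  rewrite !lognM ?muln_gt0 ?k0// (@logn_prime _ 2)// (negPf p2) !addn0.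
  exact: hk.
apply: (@pos_divisors_dvd _ _ (k * 2)%N); first exact: dvdn_mulr.
by apply: (@pos_divisors_transfer _ 2) => //; rewrite oddM andbF.
Qed.

End Transfer.

(** * Recovering a Steinitz number from its divisors *)

Lemma pos_divisors_prime_power (s : steinitz) (p : {p : nat | prime p}) k :
  pos_divisors s (val p ^ k)%N <-> (forall r, s p = Some r -> (k <= r)%N).
Proof.
have p_pr := valP p; split=> [/pos_divisorsP[_ h] r /h|h].
  by rewrite pfactorK.
apply/pos_divisorsP; split=> [|q r qr]; first by rewrite expn_gt0 prime_gt0.
have [qp|qp] := eqVneq q p; first by rewrite qp pfactorK// h// -qp.
rewrite lognX (_ : logn (val q) (val p) = 0)%N ?muln0//.
by rewrite logn_prime ?(valP q)// (inj_eq val_inj) (negPf qp).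
Qed.

Lemma steinitz_eq (s1 s2 : steinitz) :
  (forall n, pos_divisors s1 n <-> pos_divisors s2 n) -> s1 = s2.
Proof.
move=> s12; apply/boolp.funext => p.
have le k : (forall r, s1 p = Some r -> (k <= r)%N) <-> (forall r, s2 p = Some r -> (k <= r)%N).
  by rewrite -!pos_divisors_prime_power.
case e1: (s1 p) => [r1|]; case e2: (s2 p) => [r2|] //.
- congr Some; apply/eqP; rewrite eqn_leq; apply/andP; split.
    by apply: (le r1).1 => // r; rewrite e1 => -[->].
  by apply: (le r2).2 => // r; rewrite e2 => -[->].
(* An infinite exponent makes the bound vacuous, so the power [r1.+1] of [p] divides [s2] but not
   [s1]. *)
- have h r : s2 p = Some r -> (r1 < r)%N by rewrite e2.
  by have := (le r1.+1).2 h r1 e1; rewrite ltnn.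
have h r : s1 p = Some r -> (r2 < r)%N by rewrite e1.
by have := (le r2.+1).1 h r2 e2; rewrite ltnn.
Qed.

Theorem theorem3 (F : fieldType)
    (char_neq2 : 2%N \notin [pchar F]) (char_neq3 : 3%N \notin [pchar F])
    (s1 s2 : steinitz) :
  isomorphic (SLp_group F s1) (SLp_group F s2) <-> s1 = s2.
Proof.
split=> [[f f_bij]|<-]; last first.
  exists (idfun : {multiplicative SLp_group F s1 -> SLp_group F s1}).
  by exists id.
apply: steinitz_eq => n; split; first exact: (pos_divisors_iso char_neq2 f_bij).
have [f' fK f'K] := f_bij.
pose f'M := isMultiplicative.Build _ _ f' (can2_gmulfM fK f'K).
pose g : {multiplicative SLp_group F s2 -> SLp_group F s1} := HB.pack f' f'M.
by apply: (@pos_divisors_iso _ _ _ char_neq2 g); exists f.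
Qed.
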